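(* Let $K \subseteq \mathbb{R}^n$ be a symmetric convex body such that $d_{BM}(K, \mathbb{B}^n)=\sqrt{n}$. If $n \leq 3$, then $K$ is an (invertible) affine transformation of $\mathcal{P}^n$ or $\mathcal{C}^n$.
   Context: A convex body in $\mathbb{R}^n$ is a compact convex set with non-empty interior; it is symmetric if it has a center of symmetry, i.e. some translate of it is invariant under $x\mapsto -x$. $\mathbb{B}^n$ is the closed Euclidean unit ball of $\mathbb{R}^n$, $\mathcal{P}^n=[-1,1]^n$ is the unit cube, and $\mathcal{C}^n=\{x\in\mathbb{R}^n : |x_1|+\cdots+|x_n|\le 1\}$ is the unit cross-polytope. The Banach-Mazur distance of convex bodies $K,L\subseteq\mathbb{R}^n$ is $d_{BM}(K,L)=\inf\{\rho>0 : K+u\subseteq T(L+v)\subseteq\rho(K+u)\}$, where the infimum is over all invertible linear operators $T:\mathbb{R}^n\to\mathbb{R}^n$ and vectors $u,v\in\mathbb{R}^n$ (it is attained, and for origin symmetric $K,L$ one may take $u=v=0$). *)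

(* Defs.v *)
From HB Require Import structures.
From mathcomp Require Import all_boot all_order all_algebra.
From mathcomp Require Import all_classical all_reals all_analysis.

Set Implicit Arguments.
Unset Strict Implicit.
Unset Printing Implicit Defensive.

Import Order.TTheory GRing.Theory Num.Theory.
Import numFieldNormedType.Exports.

Local Open Scope classical_set_scope.
Local Open Scope ring_scope.

(* Points of R^n are column vectors. The library norm on matrices is the sup
   norm; it induces the usual topology (used for [compact] and interior), but
   it is not the Euclidean norm, which is therefore defined separately. *)

Definition enorm (R : realType) (n : nat) (x : 'cV[R]_n) : R :=
  Num.sqrt (\sum_(i < n) x i 0 ^+ 2).

Definition euclidean_ball (R : realType) (n : nat) : set 'cV[R]_n :=
  [set x : 'cV[R]_n | enorm x <= 1].

Definition unit_cube (R : realType) (n : nat) : set 'cV[R]_n :=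
  [set x : 'cV[R]_n | forall i, -1 <= x i 0 <= 1].

Definition cross_polytope (R : realType) (n : nat) : set 'cV[R]_n :=
  [set x : 'cV[R]_n | \sum_(i < n) `|x i 0| <= 1].

Definition translate (R : realType) (n : nat) (A : set 'cV[R]_n)
    (u : 'cV[R]_n) : set 'cV[R]_n := [set x + u | x in A].

Definition dilate (R : realType) (n : nat) (r : R) (A : set 'cV[R]_n) :
    set 'cV[R]_n := [set r *: x | x in A].

Definition linear_image (R : realType) (n : nat) (T : 'M[R]_n)
    (A : set 'cV[R]_n) : set 'cV[R]_n := [set T *m x | x in A].

Definition convex_body (R : realType) (n : nat) (K : set 'cV[R]_n) : Prop :=
  [/\ compact K, convex_set K & K° !=set0].

Definition symmetric_body (R : realType) (n : nat) (K : set 'cV[R]_n) : Prop :=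
  exists c : 'cV[R]_n, [set - x | x in translate K c] = translate K c.

(* For convex bodies the set of admissible factors is nonempty (and bounded
   below by 0), so the real-valued [inf] is the genuine infimum. *)
Definition banach_mazur (R : realType) (n : nat) (K L : set 'cV[R]_n) : R :=
  inf [set rho : R | 0 < rho /\
    exists (T : 'M[R]_n) (u v : 'cV[R]_n),
      [/\ T \in unitmx,
          translate K u `<=` linear_image T (translate L v) &
          linear_image T (translate L v) `<=` dilate rho (translate K u)]].

Definition affine_transform_of (R : realType) (n : nat)
    (K L : set 'cV[R]_n) : Prop :=
  exists (T : 'M[R]_n) (b : 'cV[R]_n),
    T \in unitmx /\ K = translate (linear_image T L) b.

(* Main.v *)
Require Import Defs.
From HB Require Import structures.
From mathcomp Require Import all_boot all_order all_algebra.
From mathcomp Require Import all_classical all_reals all_analysis.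
From mathcomp Require Import ring lra.

Set Implicit Arguments.
Unset Strict Implicit.
Unset Printing Implicit Defensive.

Import Order.TTheory GRing.Theory Num.Theory.
Import numFieldNormedType.Exports.

Local Open Scope classical_set_scope.
Local Open Scope ring_scope.

(** Why the theorem holds.  After a translation K is origin symmetric, and by
    compactness some linear image of K, again written K, lies in the ball of
    radius sqrt n, contains the open unit ball, and cannot be squeezed between
    two concentric balls of smaller ratio by any linear map
    ([distance_position], [pinched_exists], [pinched_position]).  Let U be the
    set of unit vectors that are limits of points outside K, and V the set of
    points of K of norm sqrt n.  As K contains the open unit ball, every u in U
    is the normal of a supporting hyperplane, so |<u, x>| <= 1 on K
    ([inner_contact_norm_le]).

    First-order variation.  Replacing K by (1 + t H) K for small t cannot
    improve the ratio, so there is no quadratic form whose values on U all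
    exceed n^-1 times all its values on V ([contact_balance]).  Separation of
    compact convex sets of matrices turns this into a common point M of the
    closed convex hulls of {u u^T} and of {v v^T / n} ([outer_hull_meet]).  Now
    M has trace 1, hence |M|^2 >= 1/n, while |M|^2 is an average of the numbers
    <u, v>^2 / n, all at most 1/n.  This forces M = I/n ([contact_identity]):
    for every H, the trace of H is at most n max_U H and at most max_V H.

    Signs.  The second inequality makes V span the space; let v_1, ..., v_n be
    a basis in V.  The equality |M|^2 = 1/n also says that the first inequality
    only sees those u with <u, v_i> = 1 or -1 for all i
    ([trace_le_sign_contact]), and such a u is determined by its sign vector.

    Either all sign vectors occur.  Then K lies between conv(v_i, -v_i) and the
    polytope cut out by the corresponding u, which is the same cross-polytope
    ([cross_polytope_position]).  Or, after changing signs of the v_i, the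
    vector (1, ..., 1) does not occur.  For n <= 2 the remaining sign vectors
    have sum 0, and the trace inequality for the form <u, v_1 + ... + v_n>^2
    gives v_1 + ... + v_n = 0, which is absurd.  For n = 3 the remaining u
    consist of three vectors and their opposites; the trace inequality makes
    the three vectors orthonormal, so K is inside the cube that they define, V
    consists of vertices of this cube, and a missing vertex would contradict
    the trace inequality for V ([cube_position]). *)

(** * The Frobenius inner product *)

(** One inner product serves column vectors and matrices, because contact points
    x are studied through the matrices x x^T. *)
Definition dot (R : realType) (m n : nat) (A B : 'M[R]_(m, n)) : R :=
  \tr (A *m B^T).

Definition sqnorm (R : realType) (m n : nat) (A : 'M[R]_(m, n)) : R := dot A A.

Lemma dotE (R : realType) m n (A B : 'M[R]_(m, n)) :
  dot A B = \sum_i \sum_j A i j * B i j.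
Proof.
rewrite /dot /mxtrace; apply: eq_bigr => i _; rewrite mxE.
by apply: eq_bigr => j _; rewrite mxE.
Qed.

Lemma dotC (R : realType) m n (A B : 'M[R]_(m, n)) : dot A B = dot B A.
Proof.
by rewrite !dotE; apply: eq_bigr => i _; apply: eq_bigr => j _; rewrite mulrC.
Qed.

Lemma dotDl (R : realType) m n (A B C : 'M[R]_(m, n)) :
  dot (A + B) C = dot A C + dot B C.
Proof. by rewrite /dot mulmxDl mxtraceD. Qed.

Lemma dotZl (R : realType) m n a (A B : 'M[R]_(m, n)) :
  dot (a *: A) B = a * dot A B.
Proof. by rewrite /dot -scalemxAl mxtraceZ. Qed.

Lemma dotDr (R : realType) m n (A B C : 'M[R]_(m, n)) :
  dot C (A + B) = dot C A + dot C B.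
Proof. by rewrite dotC dotDl !(dotC C). Qed.

Lemma dotZr (R : realType) m n a (A B : 'M[R]_(m, n)) :
  dot A (a *: B) = a * dot A B.
Proof. by rewrite dotC dotZl dotC. Qed.

Lemma dotNl (R : realType) m n (A B : 'M[R]_(m, n)) : dot (- A) B = - dot A B.
Proof. by rewrite -scaleN1r dotZl mulN1r. Qed.

Lemma dotNr (R : realType) m n (A B : 'M[R]_(m, n)) : dot A (- B) = - dot A B.
Proof. by rewrite dotC dotNl dotC. Qed.

Lemma dot0l (R : realType) m n (A : 'M[R]_(m, n)) : dot 0 A = 0.
Proof. by rewrite -[0](scale0r A) dotZl mul0r. Qed.

Lemma dot0r (R : realType) m n (A : 'M[R]_(m, n)) : dot A 0 = 0.
Proof. by rewrite dotC dot0l. Qed.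

Definition dot_lin := (dotDl, dotDr, dotNl, dotNr, dotZl, dotZr).

Lemma dot1mx (R : realType) n (A : 'M[R]_n) : dot A 1%:M = \tr A.
Proof. by rewrite /dot trmx1 mulmx1. Qed.

Lemma dot_mulmxl (R : realType) m n p (H : 'M[R]_(m, n)) (x : 'M[R]_(n, p)) y :
  dot (H *m x) y = dot x (H^T *m y).
Proof.
by rewrite /dot trmx_mul trmxK mulmxA [RHS]mxtrace_mulC mulmxA.
Qed.

Lemma dot_outer (R : realType) m n p (H : 'M[R]_(m, n)) (x : 'M[R]_(m, p))
    (y : 'M[R]_(n, p)) :
  dot H (x *m y^T) = dot x (H *m y).
Proof.
by rewrite [RHS]dotC /dot trmx_mul trmxK mulmxA.
Qed.

Lemma dot_cV (R : realType) n (x y : 'cV[R]_n) : dot x y = \sum_i x i 0 * y i 0.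
Proof. by rewrite dotE; apply: eq_bigr => i _; rewrite big_ord1. Qed.

Lemma sqnorm_cV (R : realType) n (x : 'cV[R]_n) : sqnorm x = \sum_i x i 0 ^+ 2.
Proof. by rewrite [LHS]dot_cV; apply: eq_bigr => i _; rewrite expr2. Qed.

Lemma dot_delta (R : realType) m n (M : 'M[R]_(m, n)) i j :
  dot (delta_mx i j) M = M i j.
Proof.
rewrite dotE (bigD1 i) //= (bigD1 j) //= !mxE !eqxx mul1r.
rewrite big1 => [|k /negPf kj]; last by rewrite mxE kj andbF mul0r.
rewrite big1 ?addr0 // => k /negPf ki; apply: big1 => l _.
by rewrite mxE ki mul0r.
Qed.

Lemma mulmx_row_dot (R : realType) m n (A : 'M[R]_(m, n)) (x : 'cV[R]_n) i :
  (A *m x) i 0 = dot (row i A)^T x.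
Proof. by rewrite mxE dot_cV; apply: eq_bigr => j _; rewrite !mxE. Qed.

Lemma mulmx_tr_dot (R : realType) n (x y : 'cV[R]_n) : x^T *m y = (dot x y)%:M.
Proof.
rewrite [LHS]mx11_scalar mxE dot_cV; congr _%:M.
by apply: eq_bigr => i _; rewrite mxE.
Qed.

Lemma sqnorm_ge0 (R : realType) m n (A : 'M[R]_(m, n)) : 0 <= sqnorm A.
Proof.
by rewrite /sqnorm dotE; do 2![apply: sumr_ge0 => ? _]; rewrite -expr2 sqr_ge0.
Qed.

Lemma entry_sqnorm (R : realType) m n (A : 'M[R]_(m, n)) i j :
  A i j ^+ 2 <= sqnorm A.
Proof.
rewrite /sqnorm dotE (bigD1 i) //= (bigD1 j) //= -expr2 -addrA lerDl.
rewrite addr_ge0 //.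
  by apply: sumr_ge0 => ? _; rewrite -expr2 sqr_ge0.
by do 2![apply: sumr_ge0 => ? _]; rewrite -expr2 sqr_ge0.
Qed.

Lemma sqnorm_eq0 (R : realType) m n (A : 'M[R]_(m, n)) : sqnorm A <= 0 -> A = 0.
Proof.
move=> A0; apply/matrixP => i j; rewrite mxE; apply/eqP.
by rewrite -sqrf_eq0 eq_le sqr_ge0 (le_trans (entry_sqnorm A i j)).
Qed.

Lemma sqnormD (R : realType) m n (A B : 'M[R]_(m, n)) :
  sqnorm (A + B) = sqnorm A + 2 * dot A B + sqnorm B.
Proof. by rewrite /sqnorm !dot_lin (dotC B A); ring. Qed.

Lemma sqnormZ (R : realType) m n a (A : 'M[R]_(m, n)) :
  sqnorm (a *: A) = a ^+ 2 * sqnorm A.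
Proof. by rewrite /sqnorm !dot_lin; ring. Qed.

Lemma sqnormN (R : realType) m n (A : 'M[R]_(m, n)) : sqnorm (- A) = sqnorm A.
Proof. by rewrite /sqnorm !dot_lin opprK. Qed.

Lemma cauchy_schwarz (R : realType) m n (A B : 'M[R]_(m, n)) :
  dot A B ^+ 2 <= sqnorm A * sqnorm B.
Proof.
have [B0|B0] := leP (sqnorm B) 0.
  by rewrite (sqnorm_eq0 B0) dot0r /sqnorm dot0r mulr0 expr0n.
have := sqnorm_ge0 (sqnorm B *: A - dot A B *: B).
rewrite sqnormD sqnormN !sqnormZ !dot_lin => h.
suff : 0 <= sqnorm B * (sqnorm A * sqnorm B - dot A B ^+ 2).
  by rewrite pmulr_rge0 // subr_ge0.
by apply: le_trans h _; rewrite le_eqVlt; apply/orP; left; apply/eqP; ring.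
Qed.

(** Cauchy-Schwarz on each row of H. *)
Lemma sqnorm_mulmx (R : realType) m n (H : 'M[R]_(m, n)) (x : 'cV[R]_n) :
  sqnorm (H *m x) <= sqnorm H * sqnorm x.
Proof.
rewrite {1}/sqnorm dot_cV [sqnorm H]dotE mulr_suml; apply: ler_sum => i _.
have -> : (H *m x) i 0 = dot (row i H)^T x.
  by rewrite mxE dot_cV; apply: eq_bigr => j _; rewrite !mxE.
rewrite -expr2 (le_trans (cauchy_schwarz _ _)) // ler_wpM2r ?sqnorm_ge0 //.
rewrite [sqnorm _]dot_cV le_eqVlt; apply/orP; left; apply/eqP.
by apply: eq_bigr => j _; rewrite !mxE.
Qed.

Lemma sqnorm_cols (R : realType) m n (S : 'M[R]_(m, n)) :
  sqnorm S = \sum_j sqnorm (S *m (delta_mx j 0 : 'cV_n)).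
Proof.
rewrite [LHS]dotE exchange_big; apply: eq_bigr => j _.
by rewrite [RHS]dot_cV; apply: eq_bigr => i _; rewrite -colE mxE.
Qed.

(** * Continuity and compactness for matrices *)

Lemma continuous_entry (R : realType) (T : topologicalType) m n
    (f : T -> 'M[R]_(m, n)) i j :
  continuous f -> continuous (fun x => f x i j).
Proof.
move=> cf x.
exact: (continuous_comp (cf x) (@coord_continuous R m n i j (f x))).
Qed.

Lemma continuous_dot (R : realType) (T : topologicalType) m n
    (f g : T -> 'M[R]_(m, n)) :
  continuous f -> continuous g -> continuous (fun x => dot (f x) (g x)).
Proof.
move=> cf cg.
have -> : (fun x => dot (f x) (g x)) =
    (fun x => \sum_i \sum_j f x i j * g x i j).
  by apply/funext => x; rewrite dotE.
move=> x.
apply: (@cvg_big R^o _ +%R 0 _ (@add_continuous R^o)) => i _.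
apply: (@cvg_big R^o _ +%R 0 _ (@add_continuous R^o)) => j _.
by apply: cvgM; [exact: continuous_entry cf x | exact: continuous_entry cg x].
Qed.

Lemma continuous_matrix (R : realType) (T : topologicalType) m n
    (f : T -> 'M[R]_(m, n)) :
  (forall i j, continuous (fun x => f x i j)) -> continuous f.
Proof.
move=> cf x; apply/cvg_mx_entourageP => A eA.
have : \forall y \near x, forall ij : 'I_m * 'I_n,
    (f x ij.1 ij.2, f y ij.1 ij.2) \in A.
  apply: filter_forall => -[i j] /=.
  have /cvg_entourageP/(_ A eA) := cf i j x.
  by move=> h; apply: (@filterS _ (nbhs x) _ _ _ _ h) => y Ay; rewrite inE.
move=> h; apply: (@filterS _ (nbhs x) _ _ _ _ h) => y hy i j.
exact: (hy (i, j)).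
Qed.

Lemma continuous_mulmx (R : realType) (T : topologicalType) m n p
    (f : T -> 'M[R]_(m, n)) (g : T -> 'M[R]_(n, p)) :
  continuous f -> continuous g -> continuous (fun x => f x *m g x).
Proof.
move=> cf cg; apply: continuous_matrix => i j.
have -> : (fun x => (f x *m g x) i j) =
    (fun x => \sum_k f x i k * g x k j).
  by apply/funext => x; rewrite mxE.
move=> x; apply: (@cvg_big R^o _ +%R 0 _ (@add_continuous R^o)) => k _.
by apply: cvgM; [exact: continuous_entry cf x | exact: continuous_entry cg x].
Qed.

Lemma closed_le_fun (R : realType) (T : topologicalType) (f : T -> R) c :
  continuous f -> closed [set x | f x <= c].
Proof.
by move=> cf; apply: (preimage_closed (f := f)) (@closed_le _ c) => x _.
Qed.

Lemma closed_ge_fun (R : realType) (T : topologicalType) (f : T -> R) c :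
  continuous f -> closed [set x | c <= f x].
Proof.
by move=> cf; apply: (preimage_closed (f := f)) (@closed_ge _ c) => x _.
Qed.

(** Heine-Borel for rectangular matrices, carried over from row vectors along
    [vec_mx]. *)
Lemma compact_sqnorm (R : realType) m n (A : set 'M[R]_(m, n)) r :
  closed A -> A `<=` [set x | sqnorm x <= r] -> compact A.
Proof.
move=> Acl Ar.
have cv : continuous (@vec_mx R m n).
  apply: continuous_matrix => i j.
  have -> : (fun x : 'rV[R]_(m * n) => vec_mx x i j) =
      (fun x => x 0 (mxvec_index i j)).
    by apply/funext => x; rewrite mxE.
  exact: coord_continuous.
pose B := [set v : 'rV[R]_(m * n) | forall k, v 0 k \in `[- (1 + r), 1 + r]].
have Bco : compact B.
  apply: (@rV_compact _ _ (fun=> `[- (1 + r), 1 + r]%classic)) => k.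
  exact: segment_compact.
have cB := continuous_compact (continuous_subspaceT cv) Bco.
apply: (subclosed_compact Acl cB).
move=> M /Ar /= Mr; exists (mxvec M); last by rewrite mxvecK.
move=> k /=; case/mxvec_indexP: k => i j; rewrite mxvecE in_itv /=.
have := entry_sqnorm M i j; have := sqnorm_ge0 M => h1 h2.
by apply/andP; split; nra.
Qed.

Lemma compact_min (R : realType) (T : topologicalType) (A : set T)
    (f : T -> R) :
  compact A -> A !=set0 -> continuous f ->
  exists2 a, A a & forall x, A x -> f a <= f x.
Proof.
move=> cA A0 cf.
have [a aA ha] := compact_EVT_min A0 cA (continuous_subspaceT cf).
by exists a; [rewrite inE in aA | move=> x xA; apply: ha; rewrite inE].
Qed.

(** Compactness upgrades a pointwise strict inequality to a uniform one.  The
    set may be empty, which the applications below do not exclude. *)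
Lemma compact_gap (R : realType) (T : topologicalType) (A : set T)
    (f : T -> R) c :
  compact A -> continuous f -> (forall x, A x -> c < f x) ->
  exists2 e, 0 < e & forall x, A x -> c + e <= f x.
Proof.
move=> cA cf h; have [A0|A0] := pselect (A !=set0).
  have [a aA ha] := compact_min cA A0 cf; exists (f a - c).
    by rewrite subr_gt0 h.
  by move=> x xA; rewrite addrC subrK ha.
by exists 1 => // x xA; case: A0; exists x.
Qed.

Lemma nested_compact (T : topologicalType) (A : set T) (C : nat -> set T) :
  compact A -> (forall k, closed (C k)) -> (forall k, C k `<=` A) ->
  (forall k, C k !=set0) -> (forall k l, (k <= l)%N -> C l `<=` C k) ->
  exists x, forall k, C k x.
Proof.
move=> cA Ccl CA C0 Cdec.
pose F := filter_from [set: nat] C.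
have FF : ProperFilter F.
  apply: filter_from_proper; last by move=> k _; exact: C0.
  apply: filter_from_filter; first by exists 0.
  move=> k l _ _; exists (maxn k l) => // x Cx.
  by split; apply: Cdec Cx; rewrite ?leq_maxl ?leq_maxr.
have [x [_ Fx]] := cA F FF (ex_intro2 _ _ 0%N I (CA 0%N)).
by exists x => k; apply: Ccl => B nB; apply: Fx => //; exists k.
Qed.

Lemma continuous_scale_sub (R : realType) (T : topologicalType) m n (c : R)
    (f g : T -> 'M[R]_(m, n)) :
  continuous f -> continuous g -> continuous (fun x => c *: (f x - g x)).
Proof.
move=> cf cg; apply: continuous_matrix => i j.
have -> : (fun x => (c *: (f x - g x)) i j) =
    (fun x => c * (f x i j - g x i j)).
  by apply/funext => x; rewrite !mxE.
move=> x; apply: cvgM; first exact: cvg_cst.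
by apply: cvgB; [exact: continuous_entry cf x | exact: continuous_entry cg x].
Qed.

Lemma continuous_oppf (R : realType) (T : topologicalType) (f : T -> R) :
  continuous f -> continuous (fun x => - f x).
Proof. by move=> cf x; apply: cvgN; exact: cf. Qed.

Lemma continuous_sqnorm (R : realType) m n : continuous (@sqnorm R m n).
Proof. by apply: continuous_dot => x; exact: cvg_id. Qed.

(** * Quadratic forms *)

(** The quadratic form x^T H x, written so that it is visibly linear in H. *)
Definition qform (R : realType) n (H : 'M[R]_n) (x : 'cV[R]_n) : R :=
  dot H (x *m x^T).

Lemma qformE (R : realType) n (H : 'M[R]_n) x : qform H x = dot x (H *m x).
Proof. exact: dot_outer. Qed.

Lemma qform_congr (R : realType) m n (G : 'M[R]_m) (A : 'M[R]_(m, n)) x :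
  qform (A^T *m G *m A) x = qform G (A *m x).
Proof. by rewrite !qformE dotC -!mulmxA dot_mulmxl trmxK dotC. Qed.

Lemma mxtrace_congr (R : realType) n (G A : 'M[R]_n) :
  \tr (A^T *m G *m A) = dot G (A *m A^T).
Proof. by rewrite /dot trmx_mul trmxK -mulmxA mxtrace_mulC -mulmxA. Qed.

Lemma qform_outer (R : realType) n (x y z : 'cV[R]_n) :
  qform (x *m y^T) z = dot x z * dot y z.
Proof.
by rewrite qformE -mulmxA mulmx_tr_dot mul_mx_scalar dotZr mulrC dotC.
Qed.

Lemma qformZ (R : realType) n (H : 'M[R]_n) a (x : 'cV[R]_n) :
  qform H (a *: x) = a ^+ 2 * qform H x.
Proof. by rewrite !qformE -scalemxAr !dot_lin; ring. Qed.

Lemma qform1 (R : realType) n (x : 'cV[R]_n) : qform 1%:M x = sqnorm x.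
Proof. by rewrite qformE mul1mx. Qed.

Lemma qform_const1 (R : realType) n (s : 'cV[R]_n) :
  qform (const_mx 1) s = (\sum_i s i 0) ^+ 2.
Proof.
rewrite qformE dot_cV expr2 mulr_suml; apply: eq_bigr => i _; congr (_ * _).
by rewrite mxE; apply: eq_bigr => j _; rewrite mxE mul1r.
Qed.

Lemma qform_le (R : realType) n (H : 'M[R]_n) x :
  `|qform H x| <= (1 + sqnorm H) * sqnorm x.
Proof.
rewrite -ler_sqr ?nnegrE ?mulr_ge0 ?addr_ge0 ?sqnorm_ge0 //.
rewrite real_normK ?num_real // qformE.
have h1 := cauchy_schwarz x (H *m x); have h2 := sqnorm_mulmx H x.
have h3 := sqnorm_ge0 x; have h4 := sqnorm_ge0 H.
apply: le_trans h1 _; apply: le_trans (ler_wpM2l h3 h2) _.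
have -> : sqnorm x * (sqnorm H * sqnorm x) = sqnorm H * sqnorm x ^+ 2 by ring.
by rewrite exprMn ler_wpM2r ?sqr_ge0 //; nra.
Qed.

Lemma continuous_qform (R : realType) n (H : 'M[R]_n) : continuous (qform H).
Proof.
have -> : qform H = (fun x => dot x (H *m x)).
  by apply/funext => x; rewrite qformE.
apply: continuous_dot; first by move=> x; exact: cvg_id.
by apply: (@continuous_mulmx _ _ _ _ _ (fun=> H) id);
  [exact: cst_continuous | move=> x; exact: cvg_id].
Qed.

(** * Optimal positions and their contact points *)

(** In [distance_position] the open unit ball is inside K, so a unit vector is a
    boundary point of K exactly when it is a limit of points outside K. *)
Definition inner_contact (R : realType) n (K : set 'cV[R]_n) : set 'cV[R]_n :=
  [set u | closure (~` K) u /\ sqnorm u = 1].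

Definition outer_contact (R : realType) n (K : set 'cV[R]_n) : set 'cV[R]_n :=
  [set v | K v /\ sqnorm v = n%:R].

(** Being inside K is expressed through the complement of K ([pos_inner]), which
    avoids gauges and is stable under limits of linear maps.  [pos_optimal] says
    that no linear image of K has outer and inner radii of ratio below sqrt n;
    a and b are squared radii. *)
Record distance_position (R : realType) n (K : set 'cV[R]_n) : Prop :=
  DistancePosition {
  pos_compact : compact K;
  pos_convex : forall x y (t : R), K x -> K y -> 0 <= t <= 1 ->
    K (t *: x + (1 - t) *: y);
  pos_sym : forall x, K x -> K (- x);
  pos_outer : forall x, K x -> sqnorm x <= n%:R;
  pos_inner : forall x, ~ K x -> 1 <= sqnorm x;
  pos_optimal : forall (G : 'M[R]_n) (a b : R),
    (forall x, K x -> sqnorm (G *m x) <= a) ->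
    (forall x, ~ K x -> b <= sqnorm (G *m x)) -> 0 < b -> n%:R * b <= a }.

(** If <u, x> > 1 for some x in K, then u is interior to the convex hull of x
    and the open unit ball, hence to K. *)
Lemma inner_contact_le (R : realType) n (K : set 'cV[R]_n) u x :
  distance_position K -> inner_contact K u -> K x -> dot u x <= 1.
Proof.
move=> posK [clu u1] Kx; rewrite leNgt; apply/negP => d1.
set d := dot u x in d1; have s0 := sqnorm_ge0 x; set s := sqnorm x in s0.
(* Small enough that |u - t x| < 1 - t, since |u - t x|^2 - (1 - t)^2 is
   t (t (s - 1) - 2 (d - 1)). *)
pose t := (d - 1) / (s + d).
have sd0 : 0 < s + d by lra.
have t0 : 0 < t by rewrite divr_gt0 // subr_gt0.
have tE : t * (s + d) = d - 1 by rewrite divfK // gt_eqF.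
have t1 : t < 1 by rewrite ltr_pdivrMr // ; lra.
pose f (y : 'cV[R]_n) := sqnorm ((1 - t)^-1 *: (y - t *: x)).
have cf : continuous f.
  have cg : continuous (fun y : 'cV[R]_n => (1 - t)^-1 *: (y - t *: x)).
    by apply: (@continuous_scale_sub _ _ _ _ _ id (fun=> _));
      [move=> y; exact: cvg_id | exact: cst_continuous].
  exact: (@continuous_dot _ _ _ _ _ _ cg cg).
have fu : f u < 1.
  rewrite /f sqnormZ exprVn -(ltr_pM2l (_ : 0 < (1 - t) ^+ 2));
    last by rewrite exprn_gt0 // subr_gt0.
  rewrite mulrA divff ?gt_eqF ?exprn_gt0 ?subr_gt0 // mul1r mulr1.
  rewrite sqnormD sqnormN sqnormZ u1 !dot_lin -/d -/s.
  nra.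
have [y [nKy fy]] := clu _ (cvgr_lt _ (cf u) _ fu).
apply: nKy; have Kw : K ((1 - t)^-1 *: (y - t *: x)).
  apply: contrapT => /(pos_inner posK); rewrite leNgt; exact/negP/negPn.
have -> : y = t *: x + (1 - t) *: ((1 - t)^-1 *: (y - t *: x)).
  have t1' : 1 - t != 0 by rewrite gt_eqF // subr_gt0.
  by rewrite scalerA (mulfV t1') scale1r addrC subrK.
by apply: (pos_convex posK) => //; rewrite !ltW.
Qed.

Lemma inner_contact_norm_le (R : realType) n (K : set 'cV[R]_n) u x :
  distance_position K -> inner_contact K u -> K x -> `|dot u x| <= 1.
Proof.
move=> posK uU Kx; rewrite ler_norml (inner_contact_le posK uU Kx) andbT.
by rewrite lerNl -dotNr (inner_contact_le posK uU) //; exact: pos_sym.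
Qed.

(** * First-order optimality *)

Lemma sqnorm_perturb (R : realType) n (H : 'M[R]_n) t x :
  sqnorm ((1%:M + t *: H) *m x) =
    sqnorm x + 2 * t * qform H x + t ^+ 2 * sqnorm (H *m x).
Proof.
rewrite mulmxDl mul1mx -scalemxAl sqnormD sqnormZ dotZr qformE; ring.
Qed.

Lemma small_scale (R : realType) (c e : R) :
  0 < e -> \forall t \near 0^'+, t * c < e.
Proof.
move=> e0; have c0 : 0 < 1 + `|c| by rewrite ltr_wpDr.
near=> t; have t0 : 0 < t by [].
have : t < e / (1 + `|c|) by near: t; apply: nbhs_right_lt; rewrite divr_gt0.
rewrite ltr_pdivlMr // => h; have := ler_norm c; nra.
Unshelve. all: by end_near. Qed.

(** The scalar estimate on K.  Here s = |x|^2, q = <x, H x>, h = |H x|^2, and Np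
    is the threshold for q.  Below the threshold the first-order term has the
    right size; above it, x is far from the outer contact set, so the room e in
    s <= N - e absorbs all terms of order t. *)
Lemma perturb_outer (R : realType) (N NC t Np e s q h : R) :
  0 < t -> t < 1 -> 0 <= NC -> q <= NC -> h <= NC -> s <= N ->
  (Np <= q -> s <= N - e) -> t * (3 * NC + 2 * `|Np|) < e ->
  s + 2 * t * q + t ^+ 2 * h <= N + 2 * t * Np + t ^+ 2 * NC.
Proof.
move=> t0 t1 NC0 qNC hNC sN hs te.
have th : t ^+ 2 * h <= t ^+ 2 * NC by rewrite ler_wpM2l ?sqr_ge0.
have [px|px] := leP Np q; last first.
  by have : t * q <= t * Np; [rewrite ler_pM2l // ltW | lra].
have {}hs := hs px.
have tq : t * q <= t * NC by rewrite ler_pM2l.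
have tp : t * - `|Np| <= t * Np by rewrite ler_pM2l // lerNl -normrN ler_norm.
have t2 : 0 <= t ^+ 2 * NC by rewrite mulr_ge0 ?sqr_ge0.
have t3 : 0 <= t * NC by rewrite mulr_ge0 // ltW.
lra.
Qed.

(** The scalar estimate off K, with s, q, h as above.  Far away (s > 4) the
    growth of s dominates; for s <= 4 either q exceeds the threshold m or
    x is far from the inner contact set. *)
Lemma perturb_inner (R : realType) (C t m e s q h : R) :
  0 < t -> 1 <= C -> 1 <= s -> - (C * s) <= q -> 0 <= h ->
  (s <= 4 -> q <= m -> 1 + e <= s) ->
  t * (8 * C + 2 * `|m|) < e -> t * (8 * C + 2 * `|m|) < 1 ->
  1 + 2 * t * m <= s + 2 * t * q + t ^+ 2 * h.
Proof.
move=> t0 C1 s1 Cs h0 hs te tt.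
have th : 0 <= t ^+ 2 * h by rewrite mulr_ge0 ?sqr_ge0.
have tq : - (t * (C * s)) <= t * q by rewrite -mulrN ler_pM2l.
have tm : t * m <= t * `|m| by rewrite ler_pM2l // ler_norm.
have tm0 : 0 <= t * `|m| by rewrite mulr_ge0 // ltW.
have [s4|s4] := leP s 4.
  have [qm|qm] := leP q m; last first.
    by have : t * m <= t * q; [rewrite ler_pM2l // ltW | lra].
  have := hs s4 qm.
  have : t * (C * s) <= t * (C * 4) by rewrite ler_pM2l // ler_pM2l //; lra.
  lra.
have tC0 : 0 < t * C by rewrite mulr_gt0 // (lt_le_trans ltr01).
have : (t * C) * s <= 8^-1 * s by rewrite ler_pM2r; lra.
lra.
Qed.

(** The two radii produced by the previous estimates have ratio below N once the
    quadratic error t^2 N C is smaller than the first-order gain. *)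
Lemma perturb_gain (R : realType) (N C t Np m : R) :
  0 < t -> 0 <= C -> t * (N * C) < 2 * (N * m - Np) ->
  t * (8 * C + 2 * `|m|) < 1 ->
  0 < 1 + 2 * t * m /\
  N + 2 * t * Np + t ^+ 2 * (N * C) < N * (1 + 2 * t * m).
Proof.
move=> t0 C0 h1 h2; split.
  have : t * - `|m| <= t * m by rewrite ler_pM2l // lerNl -normrN ler_norm.
  have : 0 <= t * C by rewrite mulr_ge0 // ltW.
  lra.
have : t * (t * (N * C)) < t * (2 * (N * m - Np)) by rewrite ltr_pM2l.
rewrite expr2; lra.
Qed.

(** The necessary condition for an optimal position (Ader): if H were larger on
    the inner contacts than on the rescaled outer contacts, then 1 + t H would
    lower the ratio of the radii for small t > 0. *)
Lemma contact_balance (R : realType) n (K : set 'cV[R]_n) (H : 'M[R]_n)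
    (a b : R) :
  (0 < n)%N -> distance_position K ->
  (forall u, inner_contact K u -> b <= qform H u) ->
  (forall v, outer_contact K v -> qform H v <= n%:R * a) -> b <= a.
Proof.
move=> n0 posK hU hV; rewrite leNgt; apply/negP => ab.
have {}n0 : (1 : R) <= n%:R by rewrite ler1n.
(* Two thresholds a < p < m < b: the form is above m near the inner contacts
   and below n p near the outer ones. *)
pose p := (2 * a + b) / 3; pose m := (a + 2 * b) / 3.
have ap : a < p by rewrite /p; lra.
have pm : p < m by rewrite /p /m; lra.
have mb : m < b by rewrite /m; lra.
have np : n%:R * a < n%:R * p by rewrite ltr_pM2l //; lra.
have nm : n%:R * p < n%:R * m by rewrite ltr_pM2l //; lra.
pose C := 1 + sqnorm H.
have C1 : 1 <= C by rewrite lerDl sqnorm_ge0.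
have qC x : `|qform H x| <= C * sqnorm x := qform_le H x.
have HC (x : 'cV[R]_n) : sqnorm (H *m x) <= C * sqnorm x.
  rewrite (le_trans (sqnorm_mulmx H x)) // ler_wpM2r ?sqnorm_ge0 //.
  by rewrite lerDr.
have [e1 e10 he1] : exists2 e, 0 < e & forall x, K x -> n%:R * p <= qform H x ->
    sqnorm x <= n%:R - e.
  have c1 : compact (K `&` [set x | n%:R * p <= qform H x]).
    apply: compact_closedI (pos_compact posK) _.
    exact: closed_ge_fun (@continuous_qform _ _ H).
  have [||e e0 he] := @compact_gap R _ _ (fun x => - sqnorm x) (- n%:R) c1.
  - exact: continuous_oppf (@continuous_sqnorm _ _ _).
  - move=> x [Kx px]; rewrite ltrN2 lt_neqAle (pos_outer posK Kx) andbT.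
    apply/eqP => xn.
    by have := le_lt_trans (hV x (conj Kx xn)) np; rewrite ltNge px.
  by exists e => // x Kx px; have := he x (conj Kx px); lra.
have cl1 (x : 'cV[R]_n) : closure (~` K) x -> 1 <= sqnorm x.
  have cl := @closed_ge_fun _ _ _ 1 (@continuous_sqnorm R n 1).
  move=> clx; apply: cl.
  by apply: closure_subset clx => y; exact: pos_inner.
have [e2 e20 he2] : exists2 e, 0 < e & forall x, ~ K x -> sqnorm x <= 4 ->
    qform H x <= m -> 1 + e <= sqnorm x.
  have c2 : compact (closure (~` K) `&` [set x | sqnorm x <= 4] `&`
      [set x | qform H x <= m]).
    apply: (@compact_sqnorm _ _ _ _ 4).
      apply: closedI; last exact: closed_le_fun (@continuous_qform _ _ H).
      apply: closedI; first exact: closed_closure.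
      exact: closed_le_fun (@continuous_sqnorm _ _ _).
    by move=> x [[]].
  have [||e e0 he] := @compact_gap R _ _ (@sqnorm R n 1) 1 c2.
  - exact: continuous_sqnorm.
  - move=> x [[clx x4] mx]; rewrite lt_neqAle cl1 // andbT.
    apply/eqP => x1.
    by have := lt_le_trans mb (hU x (conj clx (esym x1))); rewrite ltNge mx.
  exists e => // x nKx x4 mx; apply: he; split=> //; split=> //.
  exact: subset_closure.
near (0:R)^'+ => t.
have t0 : 0 < t by [].
have t1 : t * 1 < 1 by near: t; exact: small_scale.
have t2 : t * (n%:R * C) < 2 * (n%:R * m - n%:R * p).
  by near: t; apply: small_scale; clear -nm; lra.
have t3 : t * (3 * (n%:R * C) + 2 * `|n%:R * p|) < e1.
  by near: t; exact: small_scale.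
have t4 : t * (8 * C + 2 * `|m|) < e2 by near: t; exact: small_scale.
have t5 : t * (8 * C + 2 * `|m|) < 1 by near: t; exact: small_scale.
rewrite mulr1 in t1.
have [b0 +] := perturb_gain t0 (ltW (lt_le_trans ltr01 C1)) t2 t5.
rewrite ltNge => /negP; apply.
apply: (pos_optimal posK (G := 1%:M + t *: H)) => // [x Kx | x nKx];
  rewrite sqnorm_perturb.
- have xn : C * sqnorm x <= n%:R * C.
    rewrite mulrC ler_wpM2r ?(pos_outer posK Kx) //.
    by rewrite ltW // (lt_le_trans ltr01).
  apply: (perturb_outer t0 t1 _ _ _ (pos_outer posK Kx) (he1 x Kx) t3).
    by rewrite mulr_ge0 // (le_trans ler01).
    by rewrite (le_trans _ xn) // (le_trans (ler_norm _)).
  by rewrite (le_trans (HC x)).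
- apply: (perturb_inner t0 C1 (pos_inner posK nKx) _ _ (he2 x nKx) t4 t5).
    by rewrite lerNl (le_trans _ (qC x)) // -normrN ler_norm.
  exact: sqnorm_ge0.
Unshelve. all: by end_near. Qed.

(** * The decomposition of the identity *)

(** The closed convex hull of the matrices x x^T with x in X, described by its
    supporting half-spaces.  Its closedness and convexity are then immediate. *)
Definition outer_hull (R : realType) n (X : set 'cV[R]_n) : set 'M[R]_n :=
  [set M | forall H c, (forall x, X x -> qform H x <= c) -> dot H M <= c].

Lemma outer_hull_closed (R : realType) n (X : set 'cV[R]_n) :
  closed (outer_hull X).
Proof.
move=> M clM H c h.
have cl : closed [set N : 'M[R]_n | dot H N <= c].
  apply: closed_le_fun; apply: (@continuous_dot _ _ _ _ (fun=> H) id).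
    exact: cst_continuous.
  by move=> x; exact: cvg_id.
by apply: cl; apply: closure_subset clM => N hN; exact: hN.
Qed.

Lemma outer_hull_convex (R : realType) n (X : set 'cV[R]_n) M N (t : R) :
  outer_hull X M -> outer_hull X N -> 0 <= t <= 1 ->
  outer_hull X (M + t *: (N - M)).
Proof.
move=> hM hN /andP[t0 t1] H c h; rewrite !dot_lin.
have {}hM := hM _ _ h; have {}hN := hN _ _ h.
have := ler_wpM2l t0 hN; have : (1 - t) * dot H M <= (1 - t) * c.
  by rewrite ler_wpM2l // subr_ge0.
lra.
Qed.

Lemma outer_hull_sub (R : realType) n (X : set 'cV[R]_n) x :
  X x -> outer_hull X (x *m x^T).
Proof. by move=> Xx H c; apply. Qed.

(** A matrix M of the hull satisfies dot M M <= max_X dot M (x x^T), and each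
    dot M (x x^T) is at most the mean of |M|^2 and |x|^4. *)
Lemma outer_hull_compact (R : realType) n (X : set 'cV[R]_n) r :
  X `<=` [set x | sqnorm x <= r] -> compact (outer_hull X).
Proof.
move=> Xr; apply: (@compact_sqnorm _ _ _ _ (r ^+ 2)).
  exact: outer_hull_closed.
move=> M hM /=; have := hM M ((sqnorm M + r ^+ 2) / 2).
have h x : X x -> qform M x <= (sqnorm M + r ^+ 2) / 2.
  move=> /Xr /= xr; have := sqnorm_ge0 (M - x *m x^T).
  rewrite sqnormD sqnormN dotNr -/(qform M x).
  rewrite [sqnorm (x *m x^T)]qform_outer -/(sqnorm x) -expr2.
  have : sqnorm x ^+ 2 <= r ^+ 2.
    by rewrite ler_pXn2r ?nnegrE ?(le_trans _ xr) ?sqnorm_ge0.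
  lra.
move=> /(_ h); rewrite -/(sqnorm M); lra.
Qed.

(** 2 e is the derivative at 0 of t |-> s t^2 + 2 e t, whose minimum on [0, 1]
    is at 0. *)
Lemma convex_min_direction (R : realType) (e s : R) :
  0 <= s -> (forall t, 0 <= t <= 1 -> 0 <= 2 * t * e + t ^+ 2 * s) -> 0 <= e.
Proof.
move=> s0 h; rewrite leNgt; apply/negP => e0.
have d0 : 0 < s - e by lra.
pose t := - e / (s - e).
have t0 : 0 < t by rewrite divr_gt0 // oppr_gt0.
have t1 : t <= 1 by rewrite ler_pdivrMr //; lra.
have tE : t * (s - e) = - e by rewrite divfK // gt_eqF.
have := h t; rewrite (ltW t0) t1 => /(_ isT).
have -> : 2 * t * e + t ^+ 2 * s = t * (2 * e + t * s) by ring.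
rewrite pmulr_rge0 //; have : t * e < 0 by rewrite pmulr_rlt0.
lra.
Qed.

(** Closest points M, N of the two hulls: if they differed, the form D = M - N
    would separate X from Y. *)
Lemma outer_hull_meet (R : realType) n (X Y : set 'cV[R]_n) r :
  X `<=` [set x | sqnorm x <= r] -> Y `<=` [set x | sqnorm x <= r] ->
  (forall H a b, (forall x, X x -> b <= qform H x) ->
     (forall y, Y y -> qform H y <= a) -> b <= a) ->
  exists2 M, outer_hull X M & outer_hull Y M.
Proof.
move=> Xr Yr bal.
have q0 (x : 'cV[R]_n) : qform 0 x = 0 by rewrite qformE mul0mx dot0r.
have [[x Xx]|X0] := pselect (X !=set0); last first.
  suff : (1 : R) <= 0 by rewrite ler10.
  by apply: (bal 0) => [x Xx|y _]; [case: X0; exists x | rewrite q0].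
have [[y Yy]|Y0] := pselect (Y !=set0); last first.
  suff : (0 : R) <= -1 by rewrite ler0N1.
  by apply: (bal 0) => [z _|z Yz]; [rewrite q0 | case: Y0; exists z].
have cXY := compact_setX (outer_hull_compact Xr) (outer_hull_compact Yr).
pose f (p : 'M[R]_n * 'M[R]_n) := sqnorm (1 *: (p.1 - p.2)).
have cf : continuous f.
  have cg : continuous (fun p : 'M[R]_n * 'M[R]_n => 1 *: (p.1 - p.2)).
    by apply: continuous_scale_sub => p; [exact: cvg_fst | exact: cvg_snd].
  exact: (@continuous_dot _ _ _ _ _ _ cg cg).
have [|[M N] [/= hM hN] MNmin] := compact_min cXY _ cf.
  by exists (x *m x^T, y *m y^T); split; exact: outer_hull_sub.
pose D := M - N.
have Dmin P Q : outer_hull X P -> outer_hull Y Q -> sqnorm D <= sqnorm (P - Q).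
  by move=> hP hQ; have := MNmin (P, Q) (conj hP hQ); rewrite /f /= !scale1r.
have hX P : outer_hull X P -> dot D M <= dot D P.
  move=> hP; rewrite -subr_ge0 -dotNr -dotDr.
  apply: (convex_min_direction (sqnorm_ge0 (P - M))) => t t01.
  have := Dmin _ _ (outer_hull_convex hM hP t01) hN.
  have -> : M + t *: (P - M) - N = D + t *: (P - M) by rewrite /D addrAC.
  rewrite (sqnormD D) sqnormZ dotZr; lra.
have hY Q : outer_hull Y Q -> dot D Q <= dot D N.
  move=> hQ; rewrite -subr_ge0 -dotNr -dotDr.
  apply: (convex_min_direction (sqnorm_ge0 (N - Q))) => t t01.
  have := Dmin _ _ hM (outer_hull_convex hN hQ t01).
  have -> : M - (N + t *: (Q - N)) = D + t *: (N - Q).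
    by rewrite opprD addrA -scalerN opprB.
  rewrite (sqnormD D) sqnormZ dotZr; lra.
have := bal D (dot D N) (dot D M)
  (fun x Xx => hX _ (outer_hull_sub Xx)) (fun y Yy => hY _ (outer_hull_sub Yy)).
rewrite -subr_le0 -dotNr -dotDr -/(sqnorm D) => /sqnorm_eq0 /subr0_eq MN.
by exists M => //; rewrite MN.
Qed.

(** The common point M of the two hulls satisfies tr M = 1.  Testing M, as a
    quadratic form, on both hulls bounds |M|^2 by the maximum of <u, y>^2, which
    is at most 1/n.  Hence |M - I/n|^2 = |M|^2 - 1/n <= 0. *)
Lemma contact_identity (R : realType) n (K : set 'cV[R]_n) :
  (0 < n)%N -> distance_position K ->
  outer_hull (inner_contact K) (n%:R^-1)%:M /\
  outer_hull [set y | outer_contact K (Num.sqrt n%:R *: y)] (n%:R^-1)%:M.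
Proof.
move=> n0 posK; set U := inner_contact K; set Y := [set y | _].
have N0 : (0 : R) < n%:R by rewrite ltr0n.
have sN : Num.sqrt n%:R ^+ 2 = n%:R :> R by rewrite sqr_sqrtr ?ler0n.
have Y1 y : Y y -> sqnorm y = 1.
  move=> [_]; rewrite sqnormZ sN => h.
  by apply: (mulfI (lt0r_neq0 N0)); rewrite h mulr1.
have [|||M hU hY] := @outer_hull_meet _ _ U Y 1.
- by move=> x [_ /= ->].
- by move=> y /Y1 /= ->.
- move=> H a b hX hY; apply: (contact_balance n0 posK hX) => v vV.
  have vE : v = Num.sqrt n%:R *: ((Num.sqrt n%:R)^-1 *: v).
    by rewrite scalerA mulfV ?scale1r // gt_eqF ?sqrtr_gt0.
  rewrite vE qformZ sN ler_pM2l //; apply: hY.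
  by rewrite /Y /= -vE.
(* The form of I is constant on U, so both I and - I can be tested. *)
have M1 : dot 1%:M M = 1.
  apply/eqP; rewrite eq_le; apply/andP; split.
    by apply: hU => u [_ u1]; rewrite qform1 u1.
  rewrite -lerN2 -dotNl; apply: hU => u [_ u1].
  by rewrite qformE mulNmx mul1mx dotNr -/(sqnorm u) u1.
have Mn : sqnorm M <= n%:R^-1.
  apply: hY => y Yy; rewrite /qform dotC; apply: hU => u uU.
  rewrite qform_outer -expr2 -(ler_pM2l N0) mulfV ?gt_eqF // -sN -exprMn -dotZl.
  have [Ky _] := Yy; rewrite dotC.
  have := inner_contact_norm_le posK uU Ky.
  by rewrite -[_ ^+ 2]real_normK ?num_real // expr_le1.
suff -> : (n%:R^-1)%:M = M by [].
apply/esym/subr0_eq/sqnorm_eq0.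
rewrite sqnormD sqnormN dotNr -scalemx1 dotZr sqnormZ (dotC M) M1.
rewrite [sqnorm 1%:M]dot1mx mxtrace1 expr2 -mulrA mulVf ?gt_eqF //; lra.
Qed.

(** This and the next lemma are the two halves of the decomposition of the
    identity in dual form: I/n is tested against H. *)
Lemma trace_le_inner_contact (R : realType) n (K : set 'cV[R]_n)
    (H : 'M[R]_n) c :
  (0 < n)%N -> distance_position K ->
  (forall u, inner_contact K u -> qform H u <= c) -> \tr H <= n%:R * c.
Proof.
move=> n0 posK h; have [hU _] := contact_identity n0 posK.
have N0 : (0 : R) < n%:R by rewrite ltr0n.
have := hU _ _ h; rewrite -scalemx1 dotZr dot1mx mulrC ler_pdivrMr // mulrC.
by [].
Qed.

Lemma trace_le_outer_contact (R : realType) n (K : set 'cV[R]_n)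
    (H : 'M[R]_n) c :
  (0 < n)%N -> distance_position K ->
  (forall v, outer_contact K v -> qform H v <= c) -> \tr H <= c.
Proof.
move=> n0 posK h; have [_ hY] := contact_identity n0 posK.
have N0 : (0 : R) < n%:R by rewrite ltr0n.
have := hY H (n%:R^-1 * c).
rewrite -scalemx1 dotZr dot1mx ler_pM2l ?invr_gt0 //.
apply => y /h; rewrite qformZ sqr_sqrtr ?ler0n // => hy.
by rewrite ler_pdivlMl.
Qed.

(** * Contacts with prescribed signs *)

Lemma inner_contactN (R : realType) n (K : set 'cV[R]_n) u :
  distance_position K -> inner_contact K u -> inner_contact K (- u).
Proof.
move=> posK [clu u1]; split; last by rewrite sqnormN.
move=> B nB.
have cN : continuous (fun x : 'cV[R]_n => (-1) *: (x - 0)).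
  apply: (@continuous_scale_sub _ _ _ _ _ id (fun=> 0)) => [x|].
    exact: cvg_id.
  exact: cst_continuous.
have NE (x : 'cV[R]_n) : (-1) *: (x - 0) = - x by rewrite subr0 scaleN1r.
have nB' : nbhs u [set x | B (- x)].
  have h : nbhs u ((fun x : 'cV[R]_n => (-1) *: (x - 0)) @^-1` B).
    by apply: (cN u); rewrite NE.
  by apply: (@filterS _ (nbhs u) _ _ _ _ h) => x /=; rewrite NE.
have [x [nKx Bx]] := clu _ nB'.
exists (- x); split=> // KNx; apply: nKx.
by rewrite -(opprK x); exact: (pos_sym posK).
Qed.

Lemma outer_contactN (R : realType) n (K : set 'cV[R]_n) v :
  distance_position K -> outer_contact K v -> outer_contact K (- v).
Proof.
by move=> posK [Kv v1]; split; [exact: (pos_sym posK) | rewrite sqnormN].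
Qed.

(** The outer contacts span: a vector w orthogonal to all of them would give
    tr (w w^T) <= 0. *)
Lemma outer_contact_free (R : realType) n (K : set 'cV[R]_n) k :
  (0 < n)%N -> distance_position K -> (k <= n)%N ->
  exists2 A : 'M[R]_(k, n), row_free A & forall i, outer_contact K (row i A)^T.
Proof.
move=> n0 posK; elim: k => [_|k IH kn].
  by exists 0; [rewrite /row_free mxrank0 | case].
have [A fA VA] := IH (ltnW kn).
have [w w0 Aw] : exists2 w : 'cV[R]_n, w != 0 & A *m w = 0.
  have : cokermx A != 0.
    by rewrite -mxrank_eq0 mxrank_coker (eqP fA) -lt0n subn_gt0.
  case/matrix0Pn => i [j ij]; exists (col j (cokermx A)).
    by apply/matrix0Pn; exists i, 0; rewrite mxE.
  by rewrite colE mulmxA mulmx_coker mul0mx.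
have [v Vv vw] : exists2 v, outer_contact K v & dot w v != 0.
  apply: contrapT => hv; case/eqP: w0; apply: sqnorm_eq0.
  suff : \tr (w *m w^T) <= 0 by [].
  apply: (trace_le_outer_contact n0 posK) => v Vv; rewrite qform_outer.
  have [->|vw] := eqVneq (dot w v) 0; first by rewrite mulr0.
  by case: hv; exists v.
exists (col_mx v^T A : 'M[R]_(1 + k, n)).
  apply: (@inj_row_free _ (1 + k) n) => x.
  rewrite -[x](@hsubmxK _ _ 1 k) mul_row_col => x0.
  set a := lsubmx _ in x0 *; set y := rsubmx _ in x0 *.
  have a0 : a = 0.
    have := congr1 (fun z => z *m w) x0.
    rewrite mulmxDl -!mulmxA Aw mulmx0 addr0 mul0mx.
    rewrite mulmx_tr_dot mul_mx_scalar => /eqP.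
    by rewrite scalemx_eq0 dotC (negPf vw) => /eqP.
  move: x0; rewrite a0 mul0mx add0r => yA.
  have -> : y = 0 by apply: (row_free_inj fA); rewrite yA mul0mx.
  by rewrite row_mx0.
move=> i; case: (@split_ordP 1 k i) => j ->.
  by rewrite (@rowKu _ 1 k) ord1 row_id trmxK.
by rewrite (@rowKd _ 1 k).
Qed.

Definition sign_vector (R : realType) n (s : 'cV[R]_n) : Prop :=
  forall i, s i 0 ^+ 2 = 1.

(** The vertices of the cube are its only points of norm sqrt n. *)
Lemma sign_vector_extremal (R : realType) n (y : 'cV[R]_n) :
  (forall i, y i 0 ^+ 2 <= 1) -> sqnorm y = n%:R -> sign_vector y.
Proof.
move=> y1 yn i; apply/eqP; rewrite -subr_eq0 -oppr_eq0 opprB.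
have : \sum_i (1 - y i 0 ^+ 2) = 0.
  by rewrite sumrB -sqnorm_cV yn sumr_const card_ord subrr.
move/eqP; rewrite psumr_eq0 => [/allP/(_ i)|j _]; last by rewrite subr_ge0.
by rewrite mem_index_enum => /(_ isT).
Qed.

(** Add t sum_i <u, v_i>^2 to H with t large.  The trace of the added form is n
    times t n, its largest possible value on U, so nothing is lost at the points
    u where all <u, v_i> are 1 or -1, while the other points
    of U fall behind. *)
Lemma trace_le_sign_contact (R : realType) n (K : set 'cV[R]_n)
    (A H : 'M[R]_n) c :
  (0 < n)%N -> distance_position K ->
  (forall i, outer_contact K (row i A)^T) ->
  (forall u, inner_contact K u -> sign_vector (A *m u) -> qform H u <= c) ->
  \tr H <= n%:R * c.
Proof.
move=> n0 posK VA hH; rewrite leNgt; apply/negP => cH.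
have N0 : (0 : R) < n%:R by rewrite ltr0n.
pose e := (\tr H / n%:R - c) / 2.
have e0 : 0 < e by rewrite divr_gt0 // subr_gt0 ltr_pdivlMr // mulrC.
have HE : \tr H = n%:R * (c + 2 * e) by rewrite /e; field; rewrite gt_eqF.
have Au1 u i : inner_contact K u -> (A *m u) i 0 ^+ 2 <= 1.
  move=> uU; rewrite mulmx_row_dot dotC -[_ ^+ 2]real_normK ?num_real //.
  by rewrite expr_le1 // (inner_contact_norm_le posK uU) //; have [] := VA i.
have n1 : n%:R = \sum_(i < n) (1 : R) by rewrite sumr_const card_ord.
have cA : continuous (fun u : 'cV[R]_n => A *m u).
  apply: (@continuous_mulmx _ _ _ _ _ (fun=> A) id) => [|x]; last exact: cvg_id.
  exact: cst_continuous.
have cX : compact (inner_contact K `&` [set u | c + e <= qform H u]).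
  apply: (@compact_sqnorm _ _ _ _ 1); last by move=> u [[_ /= ->]].
  apply: closedI; last exact: closed_ge_fun (@continuous_qform _ _ H).
  have -> : inner_contact K = closure (~` K) `&`
      ([set u | sqnorm u <= 1] `&` [set u | 1 <= sqnorm u]).
    apply/seteqP; split=> u [clu]; first by move=> /= ->.
    by move=> [/= h1 h2]; split=> //; apply/eqP; rewrite eq_le h1.
  apply: closedI; first exact: closed_closure.
  apply: closedI; [exact: closed_le_fun (@continuous_sqnorm _ _ _)|].
  exact: closed_ge_fun (@continuous_sqnorm _ _ _).
have [||d d0 hd] := @compact_gap R _ _ (fun u => - sqnorm (A *m u)) (- n%:R) cX.
- exact: continuous_oppf (@continuous_dot _ _ _ _ _ _ cA cA).
- move=> u [uU cu]; rewrite ltrN2 lt_neqAle; apply/andP; split; last first.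
    by rewrite sqnorm_cV n1; apply: ler_sum => i _; exact: Au1.
  apply/eqP => h; suff /(hH u uU) : sign_vector (A *m u).
    by move: cu => /=; lra.
  by apply: sign_vector_extremal => // i; exact: Au1.
(* C bounds the excess of H over c + e on U, and t d = C makes the loss t d at
   the points where there is an excess at least as large. *)
pose C := 1 + sqnorm H + `|c + e|; pose t := C / d.
have C0 : 0 <= C by rewrite !addr_ge0 // sqnorm_ge0.
have t0 : 0 <= t by rewrite divr_ge0 // ltW.
have td : t * d = C by rewrite divfK // gt_eqF.
have qE u : qform (H + t *: (A^T *m 1%:M *m A)) u =
    qform H u + t * sqnorm (A *m u).
  rewrite {1}/qform dotDl dotZl -/(qform H u) -/(qform (A^T *m _ *m A) u).
  by rewrite qform_congr qform1.
have AA : dot 1%:M (A *m A^T) = n%:R * n%:R.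
  rewrite dotC dot1mx -/(dot A A) -/(sqnorm A) [LHS]dotE.
  rewrite (eq_bigr (fun=> n%:R)) => [|i _].
    by rewrite sumr_const card_ord mulr_natl.
  have [_ <-] := VA i; rewrite [RHS]dot_cV.
  by apply: eq_bigr => j _; rewrite !mxE.
have := @trace_le_inner_contact R n K (H + t *: (A^T *m 1%:M *m A))
  (c + e + t * n%:R) n0 posK.
rewrite mxtraceD mxtraceZ mxtrace_congr AA HE => hh.
have : n%:R * (c + 2 * e) + t * (n%:R * n%:R) <= n%:R * (c + e + t * n%:R).
  apply: hh => u uU; rewrite qE.
  have h1 : sqnorm (A *m u) <= n%:R.
    by rewrite sqnorm_cV n1; apply: ler_sum => i _; exact: Au1.
  have [cu|cu] := leP (c + e) (qform H u); last first.
    by apply: lerD; [exact: ltW | rewrite ler_wpM2l].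
  have := hd u (conj uU cu); rewrite lerNr opprD opprK => h2.
  have := ler_wpM2l t0 h2; rewrite mulrDr mulrN td.
  have [_ u1] := uU.
  have := qform_le H u; rewrite u1 mulr1 ler_norml => /andP[_].
  have := ler_norm (- (c + e)); rewrite normrN /C; lra.
have : 0 < n%:R * e by rewrite mulr_gt0.
lra.
Qed.

(** The previous lemma in the coordinates y_i = <u, v_i>, where the admissible
    contacts become sign vectors and the identity becomes the Gram matrix. *)
Lemma gram_le_sign_contact (R : realType) n (K : set 'cV[R]_n)
    (A G : 'M[R]_n) c :
  (0 < n)%N -> distance_position K -> A \in unitmx ->
  (forall i, outer_contact K (row i A)^T) ->
  (forall s, sign_vector s -> inner_contact K (invmx A *m s) ->
     qform G s <= c) ->
  dot G (A *m A^T) <= n%:R * c.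
Proof.
move=> n0 posK uA VA hG; rewrite -mxtrace_congr.
apply: (trace_le_sign_contact n0 posK VA) => u uU su; rewrite qform_congr.
by apply: hG => //; rewrite mulKmx.
Qed.

(** * The cross-polytope and the cube *)

Lemma sign_vector_cases (R : realType) n (s : 'cV[R]_n) i :
  sign_vector s -> s i 0 = 1 \/ s i 0 = -1.
Proof. by move=> /(_ i)/eqP; rewrite sqrf_eq1 => /orP[]/eqP; [left|right]. Qed.

(** Coordinates are moved to -1 or 1 one at a time; k counts those that may
    still be free. *)
Lemma cube_sub_convex (R : realType) n (D : set 'cV[R]_n) :
  (forall x y (t : R), D x -> D y -> 0 <= t <= 1 ->
     D (t *: x + (1 - t) *: y)) ->
  (forall s, sign_vector s -> D s) -> @unit_cube R n `<=` D.
Proof.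
move=> Dconv Ds.
suff h k : forall x, unit_cube x ->
    (forall i : 'I_n, (k <= i)%N -> x i 0 ^+ 2 = 1) -> D x.
  by move=> x xc; apply: (h n) => // i; rewrite leqNgt ltn_ord.
elim: k => [|k IH] x xc xk; first by apply: Ds => i; exact: xk.
have [nk|kn] := leqP n k.
  by apply: IH => // i ki; have := leq_trans nk ki; rewrite leqNgt ltn_ord.
pose j := Ordinal kn.
pose y (e : R) : 'cV[R]_n := \col_i (if i == j then e else x i 0).
have Dy e : e ^+ 2 = 1 -> D (y e).
  move=> e2; have /andP[e1 e1'] : -1 <= e <= 1.
    move/eqP: e2; rewrite sqrf_eq1 => /orP[] /eqP ->; lra.
  apply: IH => [i|i ki]; rewrite !mxE; case: eqP => [_|ij] //.
  - by rewrite e1.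
  - apply: xk; rewrite ltn_neqAle ki andbT; apply/eqP => /esym ik.
    by apply: ij; exact: val_inj.
have -> : x = ((1 + x j 0) / 2) *: y 1 + (1 - (1 + x j 0) / 2) *: y (-1).
  apply/colP => i; rewrite !mxE; by case: eqP => [->|_]; field.
have /andP[h1 h2] := xc j.
apply: Dconv; last by apply/andP; split; lra.
  by apply: Dy; rewrite expr1n.
by apply: Dy; rewrite sqrrN expr1n.
Qed.

Lemma trmx_mul_rows (R : realType) m n (A : 'M[R]_(m, n)) (z : 'cV[R]_m) :
  A^T *m z = \sum_i z i 0 *: (row i A)^T.
Proof.
apply/colP => j; rewrite mxE summxE; apply: eq_bigr => i _.
by rewrite !mxE mulrC.
Qed.

(** The point is a sum of z_i times the i-th row; partial sums stay in s D where
    s is the partial sum of the |z_i|. *)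
Lemma cross_sub_convex (R : realType) m n (D : set 'cV[R]_n)
    (A : 'M[R]_(m, n)) (z : 'cV[R]_m) :
  (forall x y (t : R), D x -> D y -> 0 <= t <= 1 ->
     D (t *: x + (1 - t) *: y)) ->
  D 0 -> (forall i, D (row i A)^T /\ D (- (row i A)^T)) ->
  cross_polytope z -> D (A^T *m z).
Proof.
move=> Dconv D0 DA zc; rewrite trmx_mul_rows.
pose Q (s : R) x := 0 <= s /\ exists2 k, D k & x = s *: k.
have [s0 [k Dk ->]] : Q (\sum_i `|z i 0|) (\sum_i z i 0 *: (row i A)^T).
  apply: (big_ind2 Q) => [|s x t y [s0 [k Dk ->]] [t0 [l Dl ->]]|i _].
  - by split=> //; exists 0; rewrite // scale0r.
  - split; first exact: addr_ge0.
    have [st0|st0] := eqVneq (s + t) 0.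
      have -> : s = 0 by lra.
      have -> : t = 0 by lra.
      by exists 0; rewrite // !scale0r !addr0 // scale0r.
    have st1 : 0 < s + t by rewrite lt_neqAle eq_sym st0 addr_ge0.
    exists ((s / (s + t)) *: k + (1 - s / (s + t)) *: l).
      apply: Dconv => //; rewrite divr_ge0 ?addr_ge0 //= ler_pdivrMr //; lra.
    rewrite scalerDr !scalerA; congr (_ *: _ + _ *: _); field; exact: st0.
  - split; first exact: normr_ge0.
    have [D1 D2] := DA i.
    case: (ger0P (z i 0)) => _; first by exists (row i A)^T.
    by exists (- (row i A)^T); rewrite // scaleNr scalerN opprK.
have := Dconv k 0 _ Dk D0; rewrite -/(cross_polytope z) in zc.
by move=> /(_ (\sum_i `|z i 0|)); rewrite scaler0 addr0; apply; rewrite s0.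
Qed.

Lemma position_zero (R : realType) n (K : set 'cV[R]_n) :
  distance_position K -> K 0.
Proof.
move=> posK; apply: contrapT => /(pos_inner posK).
by rewrite /sqnorm dot0r ler10.
Qed.

(** K contains conv(v_i, -v_i).  For x = sum_i z_i v_i in K the contact u whose
    sign vector is that of z satisfies sum_i |z_i| = <u, x> <= 1. *)
Lemma cross_polytope_position (R : realType) n (K : set 'cV[R]_n)
    (A : 'M[R]_n) :
  distance_position K -> A \in unitmx ->
  (forall i, outer_contact K (row i A)^T) ->
  (forall s, sign_vector s -> inner_contact K (invmx A *m s)) ->
  K = linear_image A^T (@cross_polytope R n).
Proof.
move=> posK uA VA US; apply/seteqP; split=> [x Kx|_ [z zc <-]]; last first.
  apply: cross_sub_convex zc.
  - exact: (pos_convex posK).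
  - exact: position_zero.
  - by move=> i; have [Kv _] := VA i; split=> //; exact: (pos_sym posK).
have uAT : A^T \in unitmx by rewrite unitmx_tr.
exists (invmx A^T *m x); last by rewrite mulKVmx.
set z := invmx A^T *m x.
pose s : 'cV[R]_n := \col_i (if 0 <= z i 0 then 1 else -1).
have ss : sign_vector s.
  by move=> i; rewrite mxE; case: ifP => _; rewrite ?sqrrN expr1n.
have := inner_contact_le posK (US s ss) Kx.
rewrite dot_mulmxl trmx_inv -/z dot_cV /cross_polytope /=; congr (_ <= _).
apply: eq_bigr => i _; rewrite mxE.
case: (ger0P (z i 0)) => _; first by rewrite mul1r.
by rewrite mulN1r.
Qed.

Lemma sum_sign2 (R : realType) n (s : 'cV[R]_n) : (n <= 2)%N -> sign_vector s ->
  s <> const_mx 1 -> s <> - const_mx 1 -> \sum_i s i 0 = 0.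
Proof.
case: n s => [|[|[|//]]] s _ ss s1 sN1.
- by rewrite big_ord0.
- case: (sign_vector_cases ord0 ss) => h; [case: s1|case: sN1];
    by apply/colP => i; rewrite (ord1 i) !mxE.
- rewrite !big_ord_recl big_ord0 addr0.
  case: (sign_vector_cases ord0 ss) => h0;
  case: (sign_vector_cases (lift ord0 ord0) ss) => h1;
  rewrite h0 h1 ?subrr ?addNr //;
  [case: s1|case: sN1]; apply/colP => i; rewrite !mxE;
  by case: (unliftP ord0 i) => [j|] ->; rewrite ?(ord1 j).
Qed.

(** A sign vector in dimension 3 that is not constant has exactly one minority
    coordinate i. *)
Lemma sign3_cases (R : realType) (s : 'cV[R]_3) : sign_vector s ->
  s <> const_mx 1 -> s <> - const_mx 1 ->
  exists i e, e ^+ 2 = 1 /\ s = e *: (const_mx 1 - 2 *: delta_mx i 0).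
Proof.
move=> ss s1 sN1.
have I3 (k : 'I_3) :
    [\/ k = ord0, k = lift ord0 ord0 | k = lift ord0 (lift ord0 ord0)].
  case: (unliftP ord0 k) => [j|] ->; last by constructor 1.
  case: (unliftP ord0 j) => [l|] ->; last by constructor 2.
  by rewrite (ord1 l); constructor 3.
have ext i e : s ord0 0 = e * (1 - 2 * (ord0 == i)%:R) ->
    s (lift ord0 ord0) 0 = e * (1 - 2 * (lift ord0 ord0 == i)%:R) ->
    s (lift ord0 (lift ord0 ord0)) 0 =
      e * (1 - 2 * (lift ord0 (lift ord0 ord0) == i)%:R) ->
    s = e *: (const_mx 1 - 2 *: delta_mx i 0).
  move=> h0 h1 h2; apply/colP => k; rewrite !mxE eqxx andbT.
  by case: (I3 k) => ->.
case: (sign_vector_cases ord0 ss) => h0;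
case: (sign_vector_cases (lift ord0 ord0) ss) => h1;
case: (sign_vector_cases (lift ord0 (lift ord0 ord0)) ss) => h2.
- by case: s1; apply/colP => k; rewrite !mxE; case: (I3 k) => ->.
- exists (lift ord0 (lift ord0 ord0)), 1; split; first by rewrite expr1n.
  by apply: ext; rewrite ?h0 ?h1 ?h2 /=; lra.
- exists (lift ord0 ord0), 1; split; first by rewrite expr1n.
  by apply: ext; rewrite ?h0 ?h1 ?h2 /=; lra.
- exists ord0, (-1); split; first by rewrite sqrrN expr1n.
  by apply: ext; rewrite ?h0 ?h1 ?h2 /=; lra.
- exists ord0, 1; split; first by rewrite expr1n.
  by apply: ext; rewrite ?h0 ?h1 ?h2 /=; lra.
- exists (lift ord0 ord0), (-1); split; first by rewrite sqrrN expr1n.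
  by apply: ext; rewrite ?h0 ?h1 ?h2 /=; lra.
- exists (lift ord0 (lift ord0 ord0)), (-1).
  split; first by rewrite sqrrN expr1n.
  by apply: ext; rewrite ?h0 ?h1 ?h2 /=; lra.
- by case: sN1; apply/colP => k; rewrite !mxE; case: (I3 k) => ->.
Qed.

Lemma sum_sign3 (R : realType) (s : 'cV[R]_3) : sign_vector s ->
  s <> const_mx 1 -> s <> - const_mx 1 -> (\sum_i s i 0) ^+ 2 = 1.
Proof.
move=> ss s1 sN1; have [i [e [e2 ->]]] := sign3_cases ss s1 sN1.
have -> : \sum_k (e *: (const_mx 1 - 2 *: delta_mx i 0) : 'cV[R]_3) k 0 = e.
  under eq_bigr do rewrite !mxE eqxx andbT.
  rewrite -mulr_sumr sumrB sumr_const card_ord -mulr_sumr (bigD1 i) //= eqxx.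
  rewrite big1 => [|j /negPf ->] //; by rewrite addr0 /= mulr1n; ring.
exact: e2.
Qed.

(** Changing to the coordinates W below turns the three remaining sign vectors
    into the standard basis, up to sign.  The trace inequality for elementary
    matrices then makes the rows of W orthogonal, and the inner contacts have
    norm 1, so W is orthogonal and its rows are inner contacts. *)
Lemma cube_position (R : realType) (K : set 'cV[R]_3) (A : 'M[R]_3) :
  distance_position K -> A \in unitmx ->
  (forall i, outer_contact K (row i A)^T) ->
  ~ inner_contact K (invmx A *m const_mx 1) ->
  exists2 T, T \in unitmx & K = linear_image T (@unit_cube R 3).
Proof.
move=> posK uA VA nU1.
pose J : 'M[R]_3 := const_mx 1.
have JJ : J *m J = 3 *: J.
  apply/matrixP => i j; rewrite !mxE; under eq_bigr do rewrite !mxE mulr1.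
  by rewrite sumr_const card_ord mulr1.
(* P sends (1, 1, 1) - 2 e_i to e_i. *)
pose P : 'M[R]_3 := 2^-1 *: (J - 1%:M).
have uP : P \in unitmx.
  have /mulmx1_unit[] : P *m (J - 2 *: 1%:M) = 1%:M; last by [].
  rewrite /P -scalemxAl mulmxBl !mulmxBr JJ -!scalemxAr !mulmx1 mul1mx.
  by apply/matrixP => i j; rewrite !mxE; field.
have Pdelta (i : 'I_3) :
    P *m (const_mx 1 - 2 *: delta_mx i 0) = delta_mx i 0 :> 'cV[R]_3.
  have Jd : J *m delta_mx i 0 = const_mx 1 :> 'cV_3.
    by apply/colP => k; rewrite -colE !mxE.
  have J1 : J *m const_mx 1 = 3 *: const_mx 1 :> 'cV_3.
    apply/colP => k; rewrite !mxE; under eq_bigr do rewrite !mxE mulr1.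
    by rewrite sumr_const card_ord mulr1.
  rewrite /P -scalemxAl mulmxBl mul1mx mulmxBr -scalemxAr Jd J1.
  by apply/colP => k; rewrite !mxE; field.
pose W := P *m A.
have uW : W \in unitmx by rewrite unitmx_mul uP.
have WU u : inner_contact K u -> sign_vector (A *m u) ->
    exists i e, e ^+ 2 = 1 /\ W *m u = e *: delta_mx i 0.
  move=> uU su; have [||i [e [e2 h]]] := sign3_cases su.
  - by move=> h; apply: nU1; rewrite -h mulKmx.
  - move=> h; apply: nU1; rewrite -[const_mx 1]opprK -h mulmxN mulKmx //.
    exact: inner_contactN.
  - by exists i, e; split=> //; rewrite /W -mulmxA h -scalemxAr Pdelta.
pose E i := exists2 u, inner_contact K u & W *m u = delta_mx i 0.
have key (G : 'M[R]_3) c :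
    (forall i, E i -> G i i <= c) -> dot G (W *m W^T) <= 3 * c.
  move=> hG; rewrite -mxtrace_congr.
  apply: (trace_le_sign_contact _ posK VA) => // u uU su; rewrite qform_congr.
  have [i [e [e2 h]]] := WU u uU su.
  rewrite h qformZ e2 mul1r qformE -colE dot_delta mxE; apply: hG.
  move/eqP: e2; rewrite sqrf_eq1 => /orP[] /eqP eE; rewrite eE in h.
    by exists u; rewrite // h scale1r.
  exists (- u); first exact: inner_contactN.
  by rewrite mulmxN h scaleN1r opprK.
have offdiag i j : i != j -> (W *m W^T) i j = 0.
  move=> ij; have ki_kj (k : 'I_3) : (k == i) && (k == j) = false.
    by apply/negbTE/negP => /andP[/eqP -> ]; rewrite (negPf ij).
  apply/eqP; rewrite eq_le -dot_delta; apply/andP; split.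
    by rewrite -(mulr0 3); apply: key => k _; rewrite mxE ki_kj mulr0n.
  rewrite -oppr_le0 -dotNl -(mulr0 3); apply: key => k _.
  by rewrite !mxE ki_kj mulr0n oppr0.
have WTd i : (W *m W^T) i i = sqnorm (W^T *m delta_mx i 0 : 'cV_3).
  by rewrite /sqnorm dot_mulmxl trmxK mulmxA dot_delta -colE [RHS]mxE.
have diag0 i : (W *m W^T) i i != 0.
  apply/eqP => h; have : W^T *m delta_mx i 0 = 0 :> 'cV_3.
    by apply: sqnorm_eq0; rewrite -WTd h.
  move/(congr1 (mulmx (invmx W^T))); rewrite mulmx0 mulKmx ?unitmx_tr //.
  by move/matrixP/(_ i 0); rewrite !mxE !eqxx => /eqP; rewrite oner_eq0.
have allE i : E i.
  have : 0 < (W *m W^T) i i by rewrite lt_neqAle eq_sym diag0 WTd sqnorm_ge0.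
  apply: contraPP => nE; apply/negP; rewrite -leNgt -dot_delta.
  rewrite -(mulr0 3); apply: key => k Ek; rewrite mxE andbb.
  by case: eqP => // ki; case: nE; rewrite -ki.
have WTE i : exists2 u, inner_contact K u &
    W^T *m delta_mx i 0 = (W *m W^T) i i *: u.
  have [u uU Wu] := allE i; exists u => //.
  rewrite -[LHS](mulKmx uW) [W *m (W^T *m _)]mulmxA.
  have -> : W *m W^T *m delta_mx i 0 = (W *m W^T) i i *: delta_mx i 0 :> 'cV_3.
    apply/colP => k.
    rewrite -colE mxE [RHS]mxE [delta_mx _ _ _ _]mxE eqxx andbT.
    by case: (k =P i) => [->|/eqP/offdiag ->]; rewrite ?mulr1 ?mulr0.
  by rewrite -scalemxAr -Wu mulKmx.
(* The i-th row of W is d times a unit contact, where d is also its squared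
   norm; hence d^2 = d. *)
have diag1 i : (W *m W^T) i i = 1.
  have [u [_ u1] h] := WTE i; have := WTd i; rewrite h sqnormZ u1 mulr1 expr2.
  by move=> h'; apply: (mulfI (diag0 i)); rewrite mulr1.
have WWT : W *m W^T = 1%:M.
  apply/matrixP => i j; rewrite [RHS]mxE.
  by case: (i =P j) => [->|/eqP/offdiag //]; rewrite diag1.
have WTW : W^T *m W = 1%:M by apply: mulmx1C.
have Wle x i : K x -> (W *m x) i 0 ^+ 2 <= 1.
  move=> Kx; have [u uU] := WTE i; rewrite diag1 scale1r => h.
  have -> : (W *m x) i 0 = dot u x by rewrite -h dot_mulmxl trmxK dot_delta.
  rewrite -[_ ^+ 2]real_normK ?num_real // expr_le1 //.
  exact: (inner_contact_norm_le posK uU).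
have KW x : K (W^T *m (W *m x)) = K x by rewrite mulmxA WTW mul1mx.
exists W^T; first by rewrite unitmx_tr.
apply/seteqP; split=> [x Kx|_ [z zc <-]].
  exists (W *m x); last by rewrite mulmxA WTW mul1mx.
  move=> i; have := Wle x i Kx; rewrite -[_ ^+ 2]real_normK ?num_real //.
  by rewrite expr_le1 // ler_norml.
apply: (@cube_sub_convex _ _ [set z | K (W^T *m z)]) zc
  => [x y t Kx Ky t01|s ss] /=.
  by rewrite mulmxDr -!scalemxAr; exact: (pos_convex posK).
apply: contrapT => nKs.
(* If the vertex s were missing, <s, W v>^2 would be 1 at every outer contact
   v, while the trace of this form is 3. *)
suff : \tr (W^T *m (s *m s^T) *m W) <= 1.
  rewrite mxtrace_congr WWT dot1mx -/(dot s s) -/(sqnorm s) sqnorm_cV.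
  rewrite (eq_bigr (fun=> 1)) => [|i _]; last exact: ss.
  by rewrite sumr_const card_ord; lra.
have n0 : (0 < 3)%N by [].
apply: (trace_le_outer_contact n0 posK) => v [Kv v3].
rewrite qform_congr qform_outer -expr2.
set y := W *m v.
have sy : sign_vector y.
  apply: sign_vector_extremal => [i|]; first exact: Wle.
  by rewrite /sqnorm dot_mulmxl mulmxA WTW mul1mx.
have y_s : y <> s by move=> h; apply: nKs; rewrite -h KW.
have y_Ns : y <> - s.
  move=> h; apply: nKs; rewrite -[s]opprK -h mulmxN.
  by apply: (pos_sym posK); rewrite KW.
(* The signs p_i are not all equal, as y is neither s nor - s. *)
pose p : 'cV[R]_3 := \col_i (s i 0 * y i 0).
have pE : dot s y = \sum_i p i 0.
  by rewrite dot_cV; apply: eq_bigr => i _; rewrite [p _ _]mxE.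
have syE i : y i 0 = s i 0 * p i 0 by rewrite [p _ _]mxE mulrA -expr2 ss mul1r.
rewrite pE sum_sign3 // => [i||] .
- by rewrite [p _ _]mxE exprMn ss sy mulr1.
- by move=> h; apply: y_s; apply/colP => i; rewrite syE h mxE mulr1.
- by move=> h; apply: y_Ns; apply/colP => i; rewrite syE h !mxE mulrN1.
Qed.

Lemma distance_position_shape (R : realType) n (K : set 'cV[R]_n) :
  (0 < n <= 3)%N -> distance_position K ->
  exists2 T, T \in unitmx &
    K = linear_image T (@unit_cube R n) \/
    K = linear_image T (@cross_polytope R n).
Proof.
move=> /andP[n0 n3] posK.
have [A fA VA] := outer_contact_free n0 posK (leqnn n).
have {fA}uA : A \in unitmx by rewrite -row_free_unit.
have [US|/existsNP[s /not_implyP[ss nUs]]] :=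
  pselect (forall s, sign_vector s -> inner_contact K (invmx A *m s)).
  exists A^T; first by rewrite unitmx_tr.
  by right; exact: cross_polytope_position.
(* Replacing v_i by s_i v_i turns the missing sign vector s into the constant
   vector 1. *)
pose D := diag_mx s^T.
have Ds : D *m s = const_mx 1.
  by apply/colP => i; rewrite mul_diag_mx !mxE -expr2 ss.
have DD : D *m D = 1%:M.
  apply/matrixP => i j; rewrite mul_diag_mx !mxE.
  by case: eqP => [->|]; rewrite ?mulr0n ?mulr0 // mulr1n -expr2 ss.
have uB : D *m A \in unitmx.
  by rewrite unitmx_mul uA andbT; case/mulmx1_unit: DD.
have VB i : outer_contact K (row i (D *m A))^T.
  have -> : (row i (D *m A))^T = s i 0 *: (row i A)^T.
    by apply/colP => j; rewrite mul_diag_mx !mxE.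
  case: (sign_vector_cases i ss) => ->; first by rewrite scale1r.
  by rewrite scaleN1r; apply: outer_contactN.
have nU1 : ~ inner_contact K (invmx (D *m A) *m const_mx 1).
  suff -> : invmx (D *m A) *m const_mx 1 = invmx A *m s by [].
  have <- : D *m A *m (invmx A *m s) = const_mx 1 by rewrite -mulmxA mulKVmx.
  by rewrite mulKmx.
have [n2|n2] := leqP n 2; last first.
  have nE : n = 3 by apply/eqP; rewrite eqn_leq n3.
  subst n; have [T uT KT] := cube_position posK uB VB nU1.
  by exists T => //; left.
(* The form y |-> (sum_i y_i)^2 vanishes on the remaining sign vectors, and its
   trace is the squared norm of the sum of the rows. *)
have := @gram_le_sign_contact _ _ _ _ (const_mx 1) 0 n0 posK uB VB.
rewrite mulr0 => h; suff : const_mx 1 = 0 :> 'cV[R]_n.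
  by move/matrixP/(_ (Ordinal n0) 0); rewrite !mxE => /eqP; rewrite oner_eq0.
have uBT : (D *m A)^T \in unitmx by rewrite unitmx_tr.
rewrite -[LHS](mulKmx uBT); set c : 'cV[R]_n := const_mx 1.
suff -> : (D *m A)^T *m c = 0 by rewrite mulmx0.
apply: sqnorm_eq0; rewrite /sqnorm dot_mulmxl trmxK mulmxA -qformE /qform dotC.
have -> : c *m c^T = const_mx 1.
  by apply/matrixP => i j; rewrite mxE big_ord1 !mxE mulr1.
apply: h => t st tU; rewrite qform_const1 sum_sign2 // ?expr0n //.
  by move=> t1; apply: nU1; rewrite -t1.
move=> t1; apply: nU1; rewrite -[const_mx 1]opprK -t1 mulmxN.
exact: inner_contactN.
Qed.

(** * Existence of an optimal position *)

(** The ball of radius sqrt r around 0 witnesses the non-empty interior. *)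
Record centered_body (R : realType) n (K : set 'cV[R]_n) (r : R) : Prop :=
  CenteredBody {
  body_compact : compact K;
  body_convex : forall x y (t : R), K x -> K y -> 0 <= t <= 1 ->
    K (t *: x + (1 - t) *: y);
  body_sym : forall x, K x -> K (- x);
  body_radius : 0 < r;
  body_ball : forall x, sqnorm x <= r -> K x }.

(** S K lies in the closed unit ball and contains the open ball of radius
    sqrt b, the latter again through the complement of K. *)
Definition pinched (R : realType) n (K : set 'cV[R]_n) (b : R)
    (S : 'M[R]_n) : Prop :=
  (forall x, K x -> sqnorm (S *m x) <= 1) /\
  (forall x, ~ K x -> b <= sqnorm (S *m x)).

Lemma convex_setE (R : realType) n (K : set 'cV[R]_n) x y (t : R) :
  convex_set K -> K x -> K y -> 0 <= t <= 1 -> K (t *: x + (1 - t) *: y).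
Proof.
move=> cK Kx Ky /andP[t0 t1].
by have := cK x y (Itv01 t0 t1); rewrite !inE; apply.
Qed.

(** Averaging a small ball inside K with its reflection moves it to the
    origin. *)
Lemma translate_centered_body (R : realType) n (K : set 'cV[R]_n) c :
  convex_body K -> [set - x | x in translate K c] = translate K c ->
  exists r, centered_body (translate K c) r.
Proof.
move=> [cK convK [x0 intx0]] symK; set K0 := translate K c.
have sK x : K0 x -> K0 (- x) by move=> Kx; rewrite /K0 -symK; exists x.
have cvK x y (t : R) : K0 x -> K0 y -> 0 <= t <= 1 ->
    K0 (t *: x + (1 - t) *: y).
  move=> [x' Kx' <-] [y' Ky' <-] t01; exists (t *: x' + (1 - t) *: y').
    exact: convex_setE.
  by apply/colP => i; rewrite !mxE; ring.
have /nbhs_ballP[e /= e0 be] := intx0.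
exists ((e / 2) ^+ 2); split=> //.
- have -> : K0 = [set 1 *: (x - - c) | x in K].
    by apply/seteqP; split=> x [y Ky <-]; exists y; rewrite // scale1r opprK.
  apply: continuous_compact cK; apply: continuous_subspaceT.
  apply: (@continuous_scale_sub _ _ _ _ _ id (fun=> - c)) => [x|].
    exact: cvg_id.
  exact: cst_continuous.
- by rewrite exprn_gt0 // divr_gt0.
move=> y yr.
have Ky (z : 'cV[R]_n) : sqnorm z <= (e / 2) ^+ 2 -> K0 (x0 + z + c).
  move=> zr; exists (x0 + z) => //; apply: be; split=> // i j.
  rewrite -ball_normE /= !mxE opprD addNKr normrN.
  have := le_trans (entry_sqnorm z i j) zr.
  rewrite -[X in X <= _]real_normK ?num_real //.
  rewrite ler_pXn2r ?nnegrE ?divr_ge0 ?(ltW e0) // => h.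
  by rewrite (le_lt_trans h) // ltr_pdivrMr //; lra.
have -> : y = 2^-1 *: (x0 + y + c) + (1 - 2^-1) *: - (x0 + - y + c).
  by apply/colP => i; rewrite !mxE; field.
apply: cvK; [exact: Ky | | by apply/andP; split; lra].
by apply: sK; apply: Ky; rewrite sqnormN.
Qed.

Lemma euclidean_ballE (R : realType) n (x : 'cV[R]_n) :
  (@euclidean_ball R n x) = (sqnorm x <= 1) :> Prop.
Proof.
rewrite /euclidean_ball /= /enorm sqnorm_cV -[in LHS]sqrtr1 ler_psqrt //.
  by rewrite qualifE /= -sqnorm_cV sqnorm_ge0.
by rewrite qualifE /=.
Qed.

(** The set whose infimum is [banach_mazur K L]. *)
Definition bm_factors (R : realType) n (K L : set 'cV[R]_n) : set R :=
  [set rho : R | 0 < rho /\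
    exists (T : 'M[R]_n) (u v : 'cV[R]_n),
      [/\ T \in unitmx,
          translate K u `<=` linear_image T (translate L v) &
          linear_image T (translate L v) `<=` dilate rho (translate K u)]].

(** Averaging an inclusion between shifted symmetric bodies with its reflection
    removes the shifts. *)
Lemma bm_factor_pinched (R : realType) n (K : set 'cV[R]_n) c r rho :
  centered_body (translate K c) r -> bm_factors K (@euclidean_ball R n) rho ->
  exists S, pinched (translate K c) (rho ^- 2) S.
Proof.
move=> bodyK [rho0 [T [u [v [uT KT TK]]]]]; exists (invmx T); split=> x.
  move=> Kx; have [k Kk kx] := Kx; have [k' Kk' kx'] := body_sym bodyK Kx.
  have [_ [b Bb <-] Tb] := KT (k + u) (ex_intro2 _ _ k Kk erefl).
  have [_ [b' Bb' <-] Tb'] := KT (k' + u) (ex_intro2 _ _ k' Kk' erefl).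
  rewrite euclidean_ballE in Bb; rewrite euclidean_ballE in Bb'.
  have -> : x = T *m (2^-1 *: (b - b')).
    have -> : b - b' = (b + v) - (b' + v) by rewrite opprD addrACA subrr addr0.
    rewrite -scalemxAr mulmxBr Tb Tb' opprD addrACA subrr addr0.
    have -> : k - k' = (k + c) - (k' + c) by rewrite opprD addrACA subrr addr0.
    by rewrite kx kx'; apply/colP => i; rewrite !mxE; field.
  rewrite mulKmx // sqnormZ.
  have := sqnorm_ge0 (b + b'); rewrite !sqnormD sqnormN dotNr; lra.
move=> nKx; rewrite leNgt; apply/negP => h; apply: nKx.
pose b := rho *: (invmx T *m x).
have b1 : sqnorm b <= 1.
  rewrite sqnormZ; move: h.
  rewrite -(ltr_pM2l (_ : 0 < rho ^+ 2)) ?exprn_gt0 //.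
  by rewrite mulfV ?gt_eqF ?exprn_gt0 // => /ltW.
have inTB (z : 'cV[R]_n) : sqnorm z <= 1 ->
    linear_image T (translate (@euclidean_ball R n) v) (T *m (z + v)).
  by move=> z1; exists (z + v) => //; exists z => //; rewrite euclidean_ballE.
have [_ [k Kk <-] hk] := TK _ (inTB b b1).
have [|_ [k' Kk' <-] hk'] := TK (T *m (- b + v)).
  by apply: inTB; rewrite sqnormN.
have -> : x = 2^-1 *: (k + c) + (1 - 2^-1) *: - (k' + c).
  have : T *m (b + v) - T *m (- b + v) = 2 *: (rho *: x).
    rewrite -mulmxBr opprD opprK addrACA subrr addr0 -mulr2n -scaler_nat.
    by rewrite -scalemxAr /b -scalemxAr mulKVmx.
  rewrite -hk -hk' => /(congr1 (fun z => (2 * rho)^-1 *: z)).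
  rewrite scalerA scalerA => h'; apply/colP => i; move/colP/(_ i): h'.
  rewrite !mxE.
  rewrite mulVf ?mulf_neq0 ?gt_eqF // mul1r => <-; field; exact: lt0r_neq0.
apply: (body_convex bodyK); [by exists k | | by apply/andP; split; lra].
by apply: (body_sym bodyK); exists k'.
Qed.

Lemma compact_sqnorm_bound (R : realType) m n (K : set 'M[R]_(m, n)) :
  compact K -> exists2 M, 0 <= M & forall x, K x -> sqnorm x <= M.
Proof.
move=> cK; have [K0|K0] := pselect (K !=set0); last first.
  by exists 0 => // x Kx; case: K0; exists x.
have [a _ ha] := compact_min cK K0 (continuous_oppf (@continuous_sqnorm R m n)).
exists (sqnorm a); first exact: sqnorm_ge0.
by move=> x /ha; rewrite lerN2.
Qed.

(** If S y = 0 with y nonzero, the whole line through y lies in K. *)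
Lemma pinch_unitmx (R : realType) n (K : set 'cV[R]_n) b (S : 'M[R]_n) :
  compact K -> 0 < b -> (forall x, ~ K x -> b <= sqnorm (S *m x)) ->
  S \in unitmx.
Proof.
move=> cK b0 hS; rewrite -unitmx_tr -row_free_unit; apply: inj_row_free => x.
move/(congr1 trmx); rewrite trmx_mul trmxK trmx0 => Sx.
apply: trmx_inj; rewrite trmx0; set y := x^T in Sx *.
have [M M0 hM] := compact_sqnorm_bound cK.
have allK (t : R) : K (t *: y).
  apply: contrapT => /hS; rewrite -scalemxAr Sx scaler0 /sqnorm dot0r leNgt.
  by rewrite b0.
apply: sqnorm_eq0; rewrite leNgt; apply/negP => y0.
have := hM _ (allK (1 + M / sqnorm y)); rewrite sqnormZ.
have q0 : 0 <= M / sqnorm y by rewrite divr_ge0 // ltW.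
have : M / sqnorm y * sqnorm y = M by rewrite divfK // gt_eqF.
set q := M / sqnorm y in q0 *; nra.
Qed.

(** A pinching with squared radii a and b yields the Banach-Mazur factor
    sqrt (a' / b') for every a' > a and b' < b.  The slack b' < b replaces the
    open inner ball by a closed one, and a' keeps the factor positive. *)
Lemma pinched_optimal (R : realType) n (K : set 'cV[R]_n) c r (S : 'M[R]_n)
    (a b : R) :
  centered_body (translate K c) r ->
  banach_mazur K (@euclidean_ball R n) = Num.sqrt n%:R ->
  (forall x, translate K c x -> sqnorm (S *m x) <= a) ->
  (forall x, ~ translate K c x -> b <= sqnorm (S *m x)) -> 0 < b ->
  n%:R * b <= a.
Proof.
move=> bodyK bmK Sa Sb b0; rewrite leNgt; apply/negP => anb.
have nb0 : 0 <= n%:R * b by rewrite mulr_ge0 // ltW.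
have a0 : 0 <= a.
  apply: le_trans (sqnorm_ge0 (S *m 0)) (Sa 0 _).
  apply: (body_ball bodyK); rewrite /sqnorm dot0r.
  exact: ltW (body_radius bodyK).
have n0 : (0 : R) < n%:R.
  rewrite lt_neqAle ler0n andbT; apply/eqP => h.
  by move: anb; rewrite -h mul0r ltNge a0.
pose a' := (a + n%:R * b) / 2.
have a'0 : 0 < a' by rewrite /a'; lra.
have aa' : a <= a' by rewrite /a'; lra.
have a'b : a' < n%:R * b by rewrite /a'; lra.
pose b' := (a' / n%:R + b) / 2.
have a'n : a' / n%:R < b by rewrite ltr_pdivrMr // mulrC.
have a'n0 : 0 < a' / n%:R by rewrite divr_gt0.
have b'0 : 0 < b' by rewrite /b'; lra.
have b'b : b' < b by rewrite /b'; lra.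
have a'b' : a' < n%:R * b' by rewrite -ltr_pdivrMl // mulrC /b'; lra.
have uS : S \in unitmx := pinch_unitmx (body_compact bodyK) b0 Sb.
pose rho := Num.sqrt (a' / b').
have rho0 : 0 < rho by rewrite sqrtr_gt0 divr_gt0.
have rho2 : rho ^+ 2 = a' / b' by rewrite sqr_sqrtr // ltW // divr_gt0.
have sa0 : 0 < Num.sqrt a' by rewrite sqrtr_gt0.
have sa2 : Num.sqrt a' ^+ 2 = a' by rewrite sqr_sqrtr // ltW.
suff Erho : bm_factors K (@euclidean_ball R n) rho.
  have : Num.sqrt n%:R <= rho.
    rewrite -bmK; apply: ge_inf Erho; exists 0 => s [s0 _]; exact: ltW.
  by rewrite leNgt; case/negP; rewrite /rho ltr_sqrt // ltr_pdivrMr.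
split=> //; exists (Num.sqrt a' *: invmx S), c, 0; split.
- by rewrite unitmxZ ?unitmx_inv // unitfE gt_eqF.
- move=> x Kx; pose y := (Num.sqrt a')^-1 *: (S *m x).
  exists y; last first.
    rewrite -scalemxAl -scalemxAr mulKmx // scalerA.
    by rewrite mulfV ?scale1r // gt_eqF.
  exists y; last by rewrite addr0.
  rewrite euclidean_ballE sqnormZ exprVn sa2 ler_pdivrMl // mulr1.
  exact: le_trans (Sa x Kx) aa'.
- move=> _ [_ [y By <-] <-]; rewrite addr0; rewrite euclidean_ballE in By.
  pose x := rho^-1 *: ((Num.sqrt a' *: invmx S) *m y).
  exists x; last by rewrite scalerA mulfV ?scale1r // gt_eqF.
  apply: contrapT => /Sb; rewrite leNgt; apply/negP/negPn.
  rewrite -scalemxAr -scalemxAl -scalemxAr mulKVmx // !sqnormZ exprVn rho2 sa2.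
  rewrite mulrA invf_div divfK ?gt_eqF //; apply: le_lt_trans b'b.
  by rewrite ler_piMr // ltW.
Qed.

(** Factors close to sqrt n give pinchings with b close to 1/n.  The pinchings
    with b >= 1/n - 1/(k+1) form a decreasing sequence of compact sets, and a
    common point is a pinching with b = 1/n. *)
Lemma pinched_exists (R : realType) n (K : set 'cV[R]_n) c r :
  (0 < n)%N -> centered_body (translate K c) r ->
  banach_mazur K (@euclidean_ball R n) = Num.sqrt n%:R ->
  exists S, pinched (translate K c) n%:R^-1 S.
Proof.
move=> n0 bodyK bmK; set K0 := translate K c.
have N0 : (0 : R) < n%:R by rewrite ltr0n.
have r0 := body_radius bodyK.
pose C k : set 'M[R]_n := pinched K0 (n%:R^-1 - k.+1%:R^-1).
pose A : set 'M[R]_n := [set S | sqnorm S <= \sum_(j < n) r^-1].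
have cA : compact A.
  apply: (@compact_sqnorm _ _ _ _ (\sum_(j < n) r^-1)); last by [].
  exact: closed_le_fun (@continuous_sqnorm _ _ _).
have cS (x : 'cV[R]_n) : continuous (fun S : 'M[R]_n => sqnorm (S *m x)).
  have c1 : continuous (fun S : 'M[R]_n => S *m x).
    apply: (@continuous_mulmx _ _ _ _ _ id (fun=> x)) => [S|].
      exact: cvg_id.
    exact: cst_continuous.
  exact: (@continuous_dot _ _ _ _ _ _ c1 c1).
have [||||S hS] := @nested_compact _ A C cA.
- move=> k S clS; split=> x hx.
    have cl := @closed_le_fun _ _ _ 1 (cS x); apply: cl.
    by apply: closure_subset clS => S' [h _]; exact: h.
  have cl := @closed_ge_fun _ _ _ (n%:R^-1 - k.+1%:R^-1) (cS x); apply: cl.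
  by apply: closure_subset clS => S' [_ h]; exact: h.
- move=> k S [h _]; rewrite /A /= sqnorm_cols; apply: ler_sum => j _.
  have : K0 (Num.sqrt r *: delta_mx j 0).
    apply: (body_ball bodyK).
    rewrite sqnormZ sqr_sqrtr ?(ltW r0) // /sqnorm dot_delta.
    by rewrite mxE !eqxx /= mulr1.
  move/h; rewrite -scalemxAr sqnormZ sqr_sqrtr ?(ltW r0) // => h1.
  by rewrite -(ler_pM2l r0) mulfV ?gt_eqF.
- move=> k; pose b : R := Num.max (n%:R^-1 - k.+1%:R^-1) (n%:R^-1 / 2).
  have N1 : (0 : R) < n%:R^-1 by rewrite invr_gt0.
  have k1 : (0 : R) < k.+1%:R^-1 by rewrite invr_gt0 ltr0n.
  have b0 : 0 < b by rewrite lt_max divr_gt0 ?orbT.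
  have bN : b < n%:R^-1.
    by rewrite gt_max gtrDl oppr_lt0 k1 ltr_pdivrMr // ltr_pMr // ltr1n.
  (* Otherwise the infimum would be that of the empty set, which is 0. *)
  have E0 : bm_factors K (@euclidean_ball R n) !=set0.
    apply: contrapT => /set0P/negP/negPn/eqP h.
    move: bmK; rewrite /banach_mazur -/(bm_factors K _) h inf0 => /esym/eqP.
    by rewrite sqrtr_eq0 leNgt N0.
  have hE : has_inf (bm_factors K (@euclidean_ball R n)).
    by split=> //; exists 0 => s [s0 _]; exact: ltW.
  have gap : 0 < Num.sqrt b^-1 - Num.sqrt n%:R.
    by rewrite subr_gt0 ltr_sqrt ?invr_gt0 // -[ltLHS]invrK ltf_pV2 // posrE.
  have [rho Erho] := inf_adherent gap hE.
  rewrite [inf _]bmK addrC subrK => rhob.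
  have [S [h1 h2]] := bm_factor_pinched bodyK Erho.
  have rho0 : 0 < rho by have [] := Erho.
  exists S; split=> // x /h2; apply: le_trans.
  apply: (@le_trans _ _ b); first by rewrite le_max lexx.
  rewrite -[leLHS]invrK lef_pV2 ?posrE ?exprn_gt0 ?invr_gt0 //.
  rewrite -[leRHS](@sqr_sqrtr _ b^-1) ?invr_ge0 ?(ltW b0) //.
  by rewrite ler_pXn2r ?nnegrE ?sqrtr_ge0 ?(ltW rho0) ?(ltW rhob).
- move=> k l kl S [h1 h2]; split=> // x /h2; apply: le_trans.
  by rewrite lerB // lef_pV2 ?posrE ?ltr0n // ler_nat.
exists S; split=> x hx; first by have [h _] := hS 0%N; exact: h.
rewrite leNgt; apply/negP => /ltr_add_invr[k hk].
by have [_ /(_ x hx)] := hS k; rewrite lerBlDr leNgt hk.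
Qed.

Lemma pinched_position (R : realType) n (K : set 'cV[R]_n) c r (S : 'M[R]_n) :
  (0 < n)%N -> centered_body (translate K c) r ->
  banach_mazur K (@euclidean_ball R n) = Num.sqrt n%:R ->
  pinched (translate K c) n%:R^-1 S ->
  S \in unitmx /\
  distance_position (linear_image (Num.sqrt n%:R *: S) (translate K c)).
Proof.
move=> n0 bodyK bmK [S1 Sn]; set K0 := translate K c.
have N0 : (0 : R) < n%:R by rewrite ltr0n.
have s0 : (0 : R) < Num.sqrt n%:R by rewrite sqrtr_gt0.
have s2 : Num.sqrt n%:R ^+ 2 = n%:R :> R by rewrite sqr_sqrtr ?ler0n.
have iN0 : (0 : R) < n%:R^-1 by rewrite invr_gt0.
have uS : S \in unitmx := pinch_unitmx (body_compact bodyK) iN0 Sn.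
split=> //; set W := _ *: S.
have uW : W \in unitmx by rewrite unitmxZ // unitfE gt_eqF.
have WE (x : 'cV[R]_n) : sqnorm (W *m x) = n%:R * sqnorm (S *m x).
  by rewrite -scalemxAl sqnormZ s2.
have outW (x : 'cV[R]_n) :
    ~ linear_image W K0 x -> exists2 y, ~ K0 y & x = W *m y.
  move=> nx; exists (invmx W *m x); last by rewrite mulKVmx.
  by move=> Ky; apply: nx; exists (invmx W *m x); rewrite ?mulKVmx.
split.
- apply: continuous_compact (body_compact bodyK); apply: continuous_subspaceT.
  apply: (@continuous_mulmx _ _ _ _ _ (fun=> W) id) => [|x]; last exact: cvg_id.
  exact: cst_continuous.
- move=> _ _ t [x Kx <-] [y Ky <-] t01; exists (t *: x + (1 - t) *: y).
    exact: (body_convex bodyK).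
  by rewrite mulmxDr -!scalemxAr.
- move=> _ [x Kx <-]; exists (- x); rewrite ?mulmxN //.
  exact: (body_sym bodyK).
- by move=> _ [x Kx <-]; rewrite WE ler_piMr ?ler0n //; exact: S1.
- move=> _ /outW[y nKy ->]; rewrite WE -[leLHS](mulfV (lt0r_neq0 N0)).
  by rewrite ler_pM2l //; exact: Sn.
- move=> G a b Ga Gb; apply: (pinched_optimal (S := G *m W) bodyK bmK) => x hx.
    by rewrite -mulmxA; apply: Ga; exists x.
  rewrite -mulmxA; apply: Gb => -[y Ky /(can_inj (mulKmx uW)) yx].
  by apply: hx; rewrite -yx.
Qed.

Lemma affine_transform_of_linear (R : realType) n (K L : set 'cV[R]_n) c
    (W T : 'M[R]_n) :
  W \in unitmx -> T \in unitmx ->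
  linear_image W (translate K c) = linear_image T L -> affine_transform_of K L.
Proof.
move=> uW uT h; exists (invmx W *m T), (- c).
split; first by rewrite unitmx_mul unitmx_inv uW.
apply/seteqP; split=> [x Kx|_ [_ [y Ly <-] <-]].
  have : linear_image T L (W *m (x + c)).
    by rewrite -h; exists (x + c) => //; exists x.
  move=> [y Ly hy]; exists (x + c); last by rewrite addrK.
  by exists y; rewrite // -mulmxA hy mulKmx.
have : linear_image W (translate K c) (T *m y) by rewrite h; exists y.
by move=> [_ [x Kx <-] Wx]; rewrite -mulmxA -Wx mulKmx // addrK.
Qed.

Theorem theorem2p4 (R : realType) (n : nat) (K : set 'cV[R]_n)
    (K_body : convex_body K) (K_sym : symmetric_body K)
    (K_dist : banach_mazur K (@euclidean_ball R n) = Num.sqrt (n%:R : R))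
    (n_le3 : (n <= 3)%N) :
  affine_transform_of K (@unit_cube R n) \/
  affine_transform_of K (@cross_polytope R n).
Proof.
case: (posnP n) => [n0|n0].
  subst n; left; exists 1%:M, 0; split; first exact: unitmx1.
  have [_ _ [x0 /interior_subset Kx0]] := K_body.
  have zero (x y : 'cV[R]_0) : x = y by apply/colP => -[].
  apply/seteqP; split=> [x _|x _]; last by rewrite (zero x x0).
  exists 0; last exact: zero.
  by exists 0; [case | exact: zero].
have [c symK] := K_sym.
have [r bodyK] := translate_centered_body K_body symK.
have [S pS] := pinched_exists n0 bodyK K_dist.
have [uS posK] := pinched_position n0 bodyK K_dist pS.
have uW : Num.sqrt n%:R *: S \in unitmx.
  by rewrite unitmxZ // unitfE gt_eqF // sqrtr_gt0 ltr0n.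
have n13 : (0 < n <= 3)%N by rewrite n0.
have [T uT [KT|KT]] := distance_position_shape n13 posK.
- by left; exact: affine_transform_of_linear uW uT KT.
- by right; exact: affine_transform_of_linear uW uT KT.
Qed.
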